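(* Let $p\in[1,\infty[$, let $(\Omega,\mathcal F,\mathbb P)$ be an atomless probability space, and let $\rho:L^p(\Omega,\mathcal F,\mathbb P)\to\mathbb R$ be convex, nondecreasing with respect to the $\mathbb P$-almost sure partial order, and law-invariant. Then the functional $\mathcal R_\rho:\mathcal M_1^{|\cdot|^p}(\mathbb R)\to\mathbb R$, $\mathcal R_\rho(\mu)=\rho(F_\mu^{\leftarrow}(U))$, is continuous with respect to the $|\cdot|^p$-weak topology. If in addition $\rho$ is translation-equivariant, i.e. $\rho(Y+t)=\rho(Y)+t$ for all $Y\in L^p(\Omega,\mathcal F,\mathbb P)$ and $t\in\mathbb R$, then $\mathcal R_\rho$ is nondecreasing with respect to the increasing convex order.
   Context: Atomless means that $(\Omega,\mathcal F,\mathbb P)$ supports a random variable $U$ uniformly distributed on $]0,1[$. $\rho$ is law-invariant if $\rho(Y)=\rho(\widetilde Y)$ whenever $Y,\widetilde Y\in L^p(\Omega,\mathcal F,\mathbb P)$ have the same law under $\mathbb P$. $\mathcal M_1^{|\cdot|^p}(\mathbb R)$ is the set of Borel probability measures $\mu$ on $\mathbb R$ with $\int|t|^p\,\mu(dt)<\infty$. $F_\mu^{\leftarrow}$ is the left-continuous quantile function of the distribution function $F_\mu$ of $\mu$. The $|\cdot|^p$-weak topology on $\mathcal M_1^{|\cdot|^p}(\mathbb R)$ is the coarsest topology for which all mappings $\mu\mapsto\int g\,d\mu$ are continuous, where $g$ ranges over the continuous functions $g:\mathbb R\to\mathbb R$ with $\sup_{y\in\mathbb R}|g(y)|/(1+|y|^p)<\infty$.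 Increasing convex order: $\mu$ is dominated by $\nu$ if $\int u\,d\mu\le\int u\,d\nu$ for every nondecreasing convex function $u:\mathbb R\to\mathbb R$ for which both integrals exist. *)

(* Defs.v *)
From HB Require Import structures.
From mathcomp Require Import all_boot all_order all_algebra.
From mathcomp Require Import all_classical all_reals all_analysis.
From mathcomp Require Import measurable_realfun.

Set Implicit Arguments.
Unset Strict Implicit.
Unset Printing Implicit Defensive.

Import Order.TTheory GRing.Theory Num.Theory.
Import numFieldNormedType.Exports.

Local Open Scope classical_set_scope.
Local Open Scope ring_scope.

(* [LspaceType mu p1] is the quotient of L^p-functions by a.e. equality, but it
   comes without algebraic operations.  Sums and convex combinations are taken
   in [LfunType mu p1] and transported along the surjection [Lclass]. *)
Section Lclass.
Context d (T : measurableType d) (R : realType).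
Variables (mu : {measure set T -> \bar R}) (p : R) (p1 : (1 <= p%:E)%E).

Section of_fun.
Variable f : LfunType mu p1.

Let g : T -> measurableTypeR R := f.

Let g_measurable : measurable_fun [set: T] g.
Proof. exact: (measurable_funPT f). Qed.

#[local] HB.instance Definition _ :=
  isMeasurableFun.Build _ _ _ _ g g_measurable.

Definition Lclass_mfun : {mfun_ mu, T >-> measurableTypeR R} :=
  \pi_({mfun_ mu, T >-> measurableTypeR R})%qT
    (g : {mfun T >-> measurableTypeR R}).

Lemma Lclass_mfunE : (Lclass_mfun : T -> R) = f %[ae mu].
Proof.
rewrite /Lclass_mfun /aqEqMfun_to_fun.
have /eqmodP/asboolP := reprK (Lclass_mfun).
exact.
Qed.

Lemma Lclass_finite_norm : finite_norm mu p%:E (Lclass_mfun : T -> R).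
Proof.
have := Lfunction_finite _ f; rewrite /finite_norm unlock.
have mp (h : T -> R) : measurable_fun [set: T] h ->
    measurable_fun [set: T] (fun x => (`|h x| `^ p)%:E).
  move=> mh; apply/measurable_EFinP.
  by apply: (measurableT_comp (measurable_powR p)); exact: measurableT_comp.
suff -> : (\int[mu]_x (`|(Lclass_mfun : T -> R) x| `^ p)%:E =
           \int[mu]_x (`|f x| `^ p)%:E)%E by [].
apply: ge0_ae_eq_integral => //.
- by apply: mp; exact: (measurable_funPT (repr Lclass_mfun)).
- by apply: mp; exact: (measurable_funPT f).
- by move: Lclass_mfunE; apply: filterS => x /= h _; rewrite h.
Qed.

#[local] HB.instance Definition _ :=
  isFinLebesgue.Build d T R mu p%:E p1 Lclass_mfun Lclass_finite_norm.

Definition Lclass : LspaceType mu p1 := [the LspaceType mu p1 of Lclass_mfun].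

End of_fun.

Lemma LclassE (f : LfunType mu p1) : (Lclass f : T -> R) = f %[ae mu].
Proof. exact: Lclass_mfunE. Qed.

End Lclass.

Section risk_functional.
Context d (T : measurableType d) (R : realType) (P : probability T R).
Variables (p : R) (p1 : (1 <= p%:E)%E).
Implicit Types rho : LspaceType P p1 -> R.

Definition Lconst (t : R) : LfunType P p1 := Lfun_Sub p1 (Lfun_cst P t p).

Definition rho_convex rho :=
  convex_function [set: LfunType P p1] (fun f => rho (Lclass f)).

Definition rho_nondecreasing rho := forall X Y : LspaceType P p1,
  {ae P, forall w, (X w : R) <= Y w} -> rho X <= rho Y.

Definition law_invariant rho := forall X Y : LspaceType P p1,
  (forall A : set R, measurable A -> pushforward P X A = pushforward P Y A) ->
  rho X = rho Y.

Definition translation_equivariant rho := forall (Y : LfunType P p1) (t : R),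
  rho (Lclass (Y + Lconst t)) = rho (Lclass Y) + t.

End risk_functional.

(* [uniform_prob] is carried by [0, 1] and charges neither endpoint, so this is
   the uniform distribution on ]0, 1[. *)
Definition uniform01 d (T : measurableType d) (R : realType)
    (P : probability T R) (U : {RV P >-> R}) :=
  forall A : set R, measurable A ->
    distribution P U A = uniform_prob (@ltr01 R) A.

Definition atomless d (T : measurableType d) (R : realType)
    (P : probability T R) := exists U : {RV P >-> R}, uniform01 U.

Section quantile.
Context (R : realType).
Implicit Types mu : probability R R.

Definition distribution_function mu (x : R) : R := fine (mu `]-oo, x]%classic).

(* The left-continuous generalized inverse on ]0, 1[; outside ]0, 1[ the set may
   have no infimum, in which case [inf] is 0. *)
Definition quantile mu (s : R) : R :=
  inf [set x | s <= distribution_function mu x].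

Section id_rv.
Variable mu : probability R R.
Let idR : R -> R := idfun.
Let idR_measurable : measurable_fun [set: R] idR.
Proof. exact: measurable_id. Qed.
#[local] HB.instance Definition _ :=
  isMeasurableFun.Build _ _ _ _ idR idR_measurable.

Let cdfE x : cdf (idR : {RV mu >-> R}) x = (distribution_function mu x)%:E.
Proof. by rewrite /distribution_function fineK// fin_num_measure. Qed.

Lemma quantile_le s x : 0 < s < 1 ->
  (quantile mu s <= x) = (s <= distribution_function mu x).
Proof.
move=> /andP[s0 s1]; rewrite /quantile.
set F := distribution_function mu.
have Fmono a b : a <= b -> F a <= F b.
  by move=> ab; rewrite -lee_fin -!cdfE; exact: cdf_nondecreasing.
pose S := [set y | s <= F y].
have S0 : S !=set0.
  have := cvg_cdfy1 (idR : {RV mu >-> R}).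
  move=> /(_ [set z | (s%:E < z)%E]) [].
    by apply: open_nbhs_nbhs; split => //=; exact: open_ereal_gt_ereal.
  move=> M [_ /(_ (M + 1))]; rewrite ltrDl ltr01 => /(_ isT)/=.
  by rewrite cdfE lte_fin => /ltW; exists (M + 1).
have Slb : has_lbound S.
  have := cvg_cdfNy0 (idR : {RV mu >-> R}).
  move=> /(_ [set z | (z < s%:E)%E]) [].
    by apply: open_nbhs_nbhs; split => //=; exact: open_ereal_lt_ereal.
  move=> M [_ /(_ (M - 1))]; rewrite gtrBl ltr01 => /(_ isT)/=.
  rewrite cdfE lte_fin => FM; exists (M - 1) => y Sy.
  rewrite leNgt; apply/negP => yM.
  by have := le_lt_trans (le_trans Sy (Fmono _ _ (ltW yM))) FM; rewrite ltxx.
have Sinf : S (inf S).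
  rewrite /S/= leNgt; apply/negP => Fs.
  have := @cdf_right_continuous _ _ _ _ (idR : {RV mu >-> R}) (inf S).
  move=> /(_ [set z | (z < s%:E)%E]) [].
    apply: open_nbhs_nbhs; split => //=; first exact: open_ereal_lt_ereal.
    by rewrite cdfE lte_fin.
  move=> e /= e0 He.
  have [y Sy ye] := inf_adherent e0 (conj S0 Slb).
  have Sy' : inf S <= y by exact: ge_inf.
  move: Sy'; rewrite le_eqVlt => /predU1P[Sy'|Sy'].
    by move: Sy; rewrite -Sy' /S/= leNgt Fs.
  have : ball_ [eta Num.Def.normr] (inf S) e y.
    by rewrite /= distrC gtr0_norm ?subr_gt0// ltrBlDl.
  move=> /He /(_ Sy')/=; rewrite cdfE lte_fin => /lt_le_trans/(_ Sy).
  by rewrite ltxx.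
apply/idP/idP => [qx|sx]; first exact: le_trans (Fmono _ _ qx).
exact: ge_inf.
Qed.

End id_rv.

Lemma distribution_function_itv mu x : 0 <= distribution_function mu x <= 1.
Proof.
by rewrite -!lee_fin fineK ?fin_num_measure// measure_ge0/= probability_le1.
Qed.

Lemma quantile_measurable mu : measurable_fun [set: R] (quantile mu).
Proof.
have -> : [set: R] = `]-oo, 0] `|` `]0, 1[ `|` ([set 1] `|` `]1, +oo[).
  apply/esym; rewrite -subTset => s _ /=; rewrite !in_itv/= andbT.
  have [|s0] := leP s 0; first by left; left.
  by have [|s1|->] := ltgtP s 1; [left; right|right; right|right; left].
apply/measurable_funU => //; first exact: measurableU.
  exact: measurableU.
split; last first.
  apply/measurable_funU => //; split; first exact: measurable_fun_set1.
  apply: (eq_measurable_fun (cst 0 : R -> R)) => // s; rewrite inE/= in_itv/= andbT => s1.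
  rewrite /quantile inf_out// => -[[x /= sx] _].
  have /andP[_ F1] := distribution_function_itv mu x.
  by have := lt_le_trans s1 (le_trans sx F1); rewrite ltxx.
apply/measurable_funU => //; split.
  apply: (eq_measurable_fun (cst 0 : R -> R)) => // s; rewrite inE/= in_itv/= => s0.
  rewrite /quantile inf_out// => -[_ [m mlb]].
  have : m <= m - 1.
    apply: mlb => /=; apply: le_trans s0 _.
    by have /andP[] := distribution_function_itv mu (m - 1).
  by rewrite lerBrDr gerDl ler10.
move=> m01; apply: (measurability _ (RGenOInfty.measurableE R)) => //.
move=> _ [_ [x ->] <-].
rewrite (_ : _ `&` _ = `]0, 1[ `&` `]distribution_function mu x, +oo[).
  exact: measurableI.
apply/seteqP; split=> s /= []; rewrite !in_itv/= !andbT => s01.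
  by rewrite ltNge quantile_le// -ltNge.
by rewrite [x < _]ltNge quantile_le// -ltNge.
Qed.

HB.instance Definition _ mu :=
  isMeasurableFun.Build _ _ _ _ (quantile mu) (quantile_measurable mu).

Lemma probability_eq_rays mu (nu : probability R R) :
    (forall x, mu `]-oo, x]%classic = nu `]-oo, x]%classic) ->
  forall A : set R, measurable A -> mu A = nu A.
Proof.
move=> munu A mA.
apply: (@measure_unique _ _ _ (@RGenOInfty.G R)
  (fun n : nat => `]- n%:R, +oo[%classic)) => //.
- exact: RGenOInfty.measurableE.
- move=> _ _ [x ->] [y ->]; exists (Num.max x y).
  by apply/seteqP; split=> z /=; rewrite !in_itv/= !andbT gt_max => /andP.
- by move=> n; exists (- n%:R).
- rewrite -subTset => x _; exists (Num.truncn `|x|).+1 => //=.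
  rewrite in_itv/= andbT ltrNl (le_lt_trans (ler_norm _))// normrN.
  exact: truncnS_gt.
- move=> _ [x ->]; rewrite -setCitvl.
  have C (m : probability R R) : m (~` `]-oo, x]) = (1 - m `]-oo, x]%classic)%E.
    exact: probability_setC.
  by apply: etrans (C mu) _; rewrite munu; exact: esym (C nu).
- by move=> n; rewrite ltey_eq fin_num_measure.
Qed.

End quantile.

Record moment_probability (R : realType) (p : R) := MomentProbability {
  moment_probability_prob :> probability R R ;
  moment_probability_fin :
    (\int[moment_probability_prob]_t (`|t| `^ p)%:E < +oo)%E }.

HB.instance Definition _ (R : realType) (p : R) :=
  gen_eqMixin (moment_probability p).
HB.instance Definition _ (R : realType) (p : R) :=
  gen_choiceMixin (moment_probability p).

Record growth_fun (R : realType) (p : R) := GrowthFun {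
  growth_fun_fun :> R -> R ;
  growth_fun_continuous : continuous growth_fun_fun ;
  growth_fun_bounded :
    has_ubound (range (fun y : R => `|growth_fun_fun y| / (1 + `|y| `^ p))) }.

(* The coarsest topology making all mu |-> \int g dmu continuous, as the supremum
   of the initial topologies of these maps. *)
Definition pweak_topology (R : realType) (p : R) :=
  sup_topology (fun g : growth_fun p => Topological.class
    (initial_topology (fun mu : moment_probability p =>
       Rintegral mu [set: R] g))).

HB.instance Definition _ (R : realType) (p : R) :=
  Topological.copy (moment_probability p) (pweak_topology p).

Section R_rho.
Context d (T : measurableType d) (R : realType) (P : probability T R).
Variables (p : R) (p1 : (1 <= p%:E)%E).
Variables (U : {RV P >-> R}) (hU : uniform01 U).

Let uniform_prob_oo (A : set R) : measurable A ->
  uniform_prob (@ltr01 R) A = uniform_prob (@ltr01 R) (`]0, 1[ `&` A).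
Proof.
move=> mA.
have eq0 : uniform_prob (@ltr01 R) (~` `]0, 1[) = 0%E.
  rewrite /uniform_prob integral_uniform_pdf.
  apply: null_set_integral => //.
  - exact: measurableI (measurableC _) _.
  - apply: measurable_funTS; apply/measurable_EFinP.
    exact: measurable_uniform_pdf.
  - rewrite (_ : _ `&` _ = [set 0; 1]).
      by apply: countable_lebesgue_measure0; exact: finite_set_countable.
    apply/seteqP; split=> x /=; rewrite !in_itv/=.
      move=> [/negP]; rewrite negb_and -!leNgt => /orP[x0|x1] /andP[].
        by move=> x0' _; left; apply/eqP; rewrite eq_le x0 x0'.
      by move=> _ x1'; right; apply/eqP; rewrite eq_le x1 x1'.
    by move=> [->|->]; rewrite ltxx ?andbF lexx ler01.
have -> : uniform_prob (@ltr01 R) A =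
  (uniform_prob (@ltr01 R) (`]0%R, 1%R[ `&` A) +
   uniform_prob (@ltr01 R) (~` `]0%R, 1%R[ `&` A))%E.
  rewrite -measureU//=.
  - by rewrite -setIUl setUv setTI.
  - exact: measurableI.
  - exact: measurableI (measurableC _) _.
  - by rewrite setIACA setICr set0I.
rewrite [X in (_ + X)%E](_ : _ = 0%E) ?adde0//.
apply/eqP; rewrite -measure_le0 -[leRHS]eq0; apply: le_measure; rewrite ?inE//.
- exact: measurableI (measurableC _) _.
- exact: measurableC.
Qed.

Let uniform_prob_ray (x : R) : 0 <= x <= 1 ->
  uniform_prob (@ltr01 R) `]-oo, x]%classic = x%:E.
Proof.
move=> /andP[x0 x1]; rewrite /uniform_prob integral_uniform_pdf.
rewrite (_ : _ `&` _ = `[0, x]%classic); last first.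
  apply/seteqP; split=> y /=; rewrite !in_itv/=.
    by move=> [-> /andP[->]].
  by move=> /andP[-> yx]; rewrite yx (le_trans yx).
rewrite (eq_integral (cst 1%E)); last first.
  move=> y; rewrite inE/= in_itv/= => /andP[y0 yx].
  by rewrite /uniform_pdf y0 (le_trans yx x1)/= subr0 invr1.
rewrite integral_cst//= mul1e lebesgue_measure_itv/= lte_fin.
by move: x0; rewrite le_eqVlt => /predU1P[<-|->]; rewrite ?ltxx// sube0.
Qed.

Lemma quantile_distribution (mu : probability R R) (A : set R) :
  measurable A -> pushforward P (quantile mu \o U) A = mu A.
Proof.
move=> mA.
apply: (@probability_eq_rays _ (distribution P ((quantile mu \o U) : {RV P >-> R}))) => // x.
have mq : measurable (quantile mu @^-1` `]-oo, x]).
  by rewrite -[X in measurable X]setTI; exact: quantile_measurable.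
transitivity (distribution P U (quantile mu @^-1` `]-oo, x])); first by [].
rewrite hU// uniform_prob_oo//.
rewrite (_ : _ `&` _ = `]0, 1[ `&` `]-oo, distribution_function mu x]).
  rewrite -uniform_prob_oo// uniform_prob_ray ?distribution_function_itv//.
  by rewrite fineK// fin_num_measure.
by apply/seteqP; split=> s /= []; rewrite !in_itv/= => s01; rewrite quantile_le.
Qed.

Lemma quantile_Lfun (mu : moment_probability p) :
  (quantile mu \o U) \in Lfun P p%:E.
Proof.
apply/andP; split; rewrite inE/=; first exact: measurable_funPT.
rewrite /finite_norm unlock; apply: poweR_lty.
pose f (t : R) := (`|t| `^ p)%:E.
have mf : measurable_fun [set: R] f.
  apply/measurable_EFinP.
  exact: (measurableT_comp (measurable_powR p)).
have := moment_probability_fin mu.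
rewrite (@eq_measure_integral _ _ _ _ (distribution P ((quantile mu \o U) : {RV P >-> R}))).
  by rewrite ge0_integral_distribution// => y; rewrite lee_fin powR_ge0.
by move=> A mA _; apply/esym; exact: quantile_distribution.
Qed.

Definition R_rho (rho : LspaceType P p1 -> R) (mu : moment_probability p) : R :=
  rho (Lclass (Lfun_Sub p1 (quantile_Lfun mu))).

End R_rho.

(* Existence of an integral is understood as integrability.  On measures with a
   finite first moment, where convex functions have integrable negative parts,
   also admitting the value +oo gives the same order. *)
Definition icx_le (R : realType) (mu nu : probability R R) :=
  forall u : R -> R,
    {homo u : x y / x <= y} ->
    convex_function [set: R^o] (u : R^o -> R^o) ->
    mu.-integrable [set: R] (EFin \o u) ->
    nu.-integrable [set: R] (EFin \o u) ->
    (Rintegral mu [set: R] u <= Rintegral nu [set: R] u).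

(* Main.v *)
(** Write [Q mu = quantile mu \o U], so that [R_rho mu = rho (Q mu)].

    A finite convex monotone functional on L^p is norm continuous: along a
    sequence [Y_n] tending fast enough to [X] there is [Z] in L^p with
    [n * |Y_n - X| <= Z], and convexity bounds [n * |rho Y_n - rho X|] by
    [rho (X + Z) - rho X].  Moreover [nu |-> Q nu] is continuous into L^p: the
    tails of [Q nu] are controlled by one test function, and the event that
    [Q mu] lies below [a] while [Q nu] lies above [b] has probability at most the
    difference of the integrals of a ramp between [a] and [b], because both
    quantile functions are monotone in the same [U].

    For monotonicity, average [Q mu] and [Q nu] over [n] cells of equal
    probability on which [U] is ordered.  The increasing convex order makes the
    first vector of averages weakly majorized by the second one, and
    [y |-> rho (\sum_k y_k 1_(A_k))] is convex, monotone and, by law invariance,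
    symmetric, hence monotone for weak majorization; then let [n] grow. *)

Require Import Defs.
From mathcomp Require Import all_boot all_order all_algebra perm.
From mathcomp Require Import all_classical all_reals all_analysis.
From mathcomp Require Import measurable_realfun ring lra.

Set Implicit Arguments.
Unset Strict Implicit.
Unset Printing Implicit Defensive.

Import Order.TTheory GRing.Theory Num.Theory.
Import numFieldNormedType.Exports.

Local Open Scope classical_set_scope.
Local Open Scope ring_scope.

(** * Moments of order [p] *)

(** The sum is at most twice the larger of the two absolute values, and the power of a maximum is at
    most the sum of the powers. *)
Lemma powR_normD_le (R : realType) (p a b : R) : 0 <= p ->
  `|a + b| `^ p <= 2 `^ p * (`|a| `^ p + `|b| `^ p).
Proof.
move=> p0; set m := Num.max `|a| `|b|.
have ab : `|a + b| <= 2 * m.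
  rewrite (le_trans (ler_normD _ _))// mulr_natl mulr2n.
  by rewrite lerD// le_max lexx ?orbT.
apply: (le_trans (ge0_ler_powR p0 _ _ ab)); rewrite ?nnegrE ?normr_ge0//.
  by rewrite mulr_ge0// le_max normr_ge0.
rewrite powRM//; last by rewrite le_max normr_ge0.
rewrite ler_wpM2l ?powR_ge0// /m.
by case: (leP `|a| `|b|) => _; rewrite ?lerDl ?lerDr powR_ge0.
Qed.

(** Young's inequality for [t] and [m ^ (p - 1)] with conjugate exponents [p] and [p / (p - 1)],
    rearranged; [p = 1] is treated apart since its conjugate exponent is infinite. The tangent later
    yields Jensen's inequality on a cell. *)
Lemma powR_tangent_le (R : realType) (p m t : R) : 1 <= p -> 0 <= m -> 0 <= t ->
  m `^ p + p * m `^ (p - 1) * (t - m) <= t `^ p.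
Proof.
rewrite le_eqVlt => /predU1P[<-|p1] m0 t0.
  by rewrite subrr powRr0 !powRr1//; lra.
have p0 : 0 < p by lra.
have q0 : 0 < p / (p - 1) by rewrite divr_gt0//; lra.
have pq : p^-1 + (p / (p - 1))^-1 = 1 by field; lra.
have := conjugate_powR t0 (powR_ge0 m (p - 1)) p0 q0 pq.
rewrite -powRrM (_ : (p - 1) * (p / (p - 1)) = p); last by field; lra.
rewrite -(ler_pM2l p0) => /le_trans h.
rewrite mulrBr -(mulrA p _ m) [_ * m]mulrC mulr_powRB1//.
have {h} : p * (t * m `^ (p - 1)) <= t `^ p + (p - 1) * m `^ p.
  by apply: h; rewrite le_eqVlt; apply/orP; left; apply/eqP; field; lra.
by rewrite [t * _]mulrC; lra.
Qed.

Section ge0_integral_EFin.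
Context d (T : measurableType d) (R : realType).
Variable mu : {measure set T -> \bar R}.
Implicit Types f g : T -> R.

Lemma ae_ge0_le_integral_EFin f g :
  measurable_fun setT f -> measurable_fun setT g ->
  (forall w, 0 <= f w) -> (forall w, 0 <= g w) ->
  {ae mu, forall w, f w <= g w} ->
  (\int[mu]_w (f w)%:E <= \int[mu]_w (g w)%:E)%E.
Proof.
move=> mf mg f0 g0 fg; apply: ae_ge0_le_integral => //.
- by move=> w _; rewrite lee_fin.
- exact/measurable_EFinP.
- by move=> w _; rewrite lee_fin.
- exact/measurable_EFinP.
- by apply: filterS fg => w fgw _; rewrite lee_fin.
Qed.

Lemma ge0_integralD_EFin f g :
  measurable_fun setT f -> measurable_fun setT g ->
  (forall w, 0 <= f w) -> (forall w, 0 <= g w) ->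
  (\int[mu]_w (f w + g w)%:E = \int[mu]_w (f w)%:E + \int[mu]_w (g w)%:E)%E.
Proof.
move=> mf mg f0 g0; under eq_integral do rewrite EFinD.
apply: ge0_integralD => //.
- by move=> w _; rewrite lee_fin.
- exact/measurable_EFinP.
- by move=> w _; rewrite lee_fin.
- exact/measurable_EFinP.
Qed.

Lemma ge0_integralZl_EFin_fun f (k : R) : measurable_fun setT f ->
  (forall w, 0 <= f w) -> 0 <= k ->
  (\int[mu]_w (k * f w)%:E = k%:E * \int[mu]_w (f w)%:E)%E.
Proof.
move=> mf f0 k0; under eq_integral do rewrite EFinM.
apply: ge0_integralZl => //; first exact/measurable_EFinP.
by move=> w _; rewrite lee_fin.
Qed.

Lemma ae_eq_preimage f g (A : set R) :
  measurable_fun setT f -> measurable_fun setT g -> measurable A ->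
  {ae mu, forall w, f w = g w} -> mu (f @^-1` A) = mu (g @^-1` A).
Proof.
move=> mf mg mA fg.
have muE (h : T -> R) : measurable_fun setT h ->
    mu (h @^-1` A) = (\int[mu]_w (\1_A (h w))%:E)%E.
  move=> mh; have mhA : measurable (h @^-1` A).
    by rewrite -[X in measurable X]setTI; exact: mh.
  by rewrite -[LHS](congr1 mu (setIT _)) -integral_indic.
have m1 (h : T -> R) : measurable_fun setT h -> measurable_fun setT (fun w => (\1_A (h w) : R)%:E).
  move=> mh; have m1A : measurable_fun setT (\1_A \o h : T -> R).
    by apply: measurableT_comp => //; exact: measurable_indic.
  exact/measurable_EFinP.
rewrite !muE//; apply: ge0_ae_eq_integral => //; [exact: m1..|].
by apply: filterS fg => w fgw _; rewrite fgw.
Qed.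

End ge0_integral_EFin.

Lemma integral_cst_probability d (T : measurableType d) (R : realType)
    (P : probability T R) (c : R) : (\int[P]_w c%:E = c%:E)%E.
Proof.
rewrite (integral_cst P measurableT c%:E) -[RHS]mule1; congr (_ * _)%E.
exact: probability_setT.
Qed.

Section Lp_moment.
Context d (T : measurableType d) (R : realType) (P : probability T R).
Variables (p : R) (p1 : (1 <= p%:E)%E).
Local Notation Lp := (Lfun P p%:E).

(** The [p]-th power of the L^p norm. Closeness in L^p is measured by it, so no [p]-th roots are
    needed. *)
Definition moment (f : T -> R) : \bar R := (\int[P]_w (`|f w| `^ p)%:E)%E.

Let p_ge1 : 1 <= p. Proof. by rewrite -lee_fin. Qed.
Let p_gt0 : 0 < p. Proof. exact: lt_le_trans p_ge1. Qed.

Lemma measurable_fun_norm_powR (f : T -> R) : measurable_fun setT f ->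
  measurable_fun setT (fun w => `|f w| `^ p).
Proof.
by move=> mf; apply: (measurableT_comp (measurable_powR p)); exact: measurableT_comp.
Qed.

Lemma Lfun_momentP (f : T -> R) :
  (f \in Lp) <-> measurable_fun setT f /\ (moment f < +oo)%E.
Proof.
have e : finite_norm P p%:E f <-> (moment f < +oo)%E.
  rewrite /finite_norm unlock /moment; split=> [|h]; last exact: poweR_lty.
  by apply: lty_poweRy; rewrite invr_eq0 gt_eqF.
split=> [/andP[]|[mf h]].
  by rewrite !inE/= => mf fp; split=> //; apply/e.
by rewrite inE; apply/andP; rewrite !inE/=; split=> //; apply/e.
Qed.

Lemma le_moment (f g : T -> R) :
  measurable_fun setT f -> measurable_fun setT g ->
  {ae P, forall w, `|f w| <= `|g w|} -> (moment f <= moment g)%E.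
Proof.
move=> mf mg fg; apply: ae_ge0_le_integral_EFin.
- exact: measurable_fun_norm_powR.
- exact: measurable_fun_norm_powR.
- by move=> w; rewrite powR_ge0.
- by move=> w; rewrite powR_ge0.
- by apply: filterS fg => w h; rewrite ge0_ler_powR ?nnegrE// ltW.
Qed.

(** Plays the part of the triangle inequality for [moment], at the cost of a factor [2 ^ p]. *)
Lemma momentD_le (f g : T -> R) :
  measurable_fun setT f -> measurable_fun setT g ->
  (moment (fun w => f w + g w)%R <= (2 `^ p)%:E * (moment f + moment g))%E.
Proof.
move=> mf mg.
have mfp := measurable_fun_norm_powR mf; have mgp := measurable_fun_norm_powR mg.
have fg0 w : 0 <= `|f w| `^ p + `|g w| `^ p by rewrite addr_ge0 ?powR_ge0.
have mfg := measurable_funD mfp mgp.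
rewrite /moment -ge0_integralD_EFin//; [|by move=> w; exact: powR_ge0..].
rewrite -ge0_integralZl_EFin_fun ?powR_ge0//.
apply: ae_ge0_le_integral_EFin.
- by apply: measurable_fun_norm_powR; exact: measurable_funD.
- exact: measurable_funM.
- by move=> w; rewrite powR_ge0.
- by move=> w; rewrite mulr_ge0 ?powR_ge0.
- by apply: aeW => w; rewrite powR_normD_le// ltW.
Qed.

Lemma Lfun_measurable f : f \in Lp -> measurable_fun setT f.
Proof. by move/Lfun_momentP => -[]. Qed.

Lemma Lfun_moment_lty f : f \in Lp -> (moment f < +oo)%E.
Proof. by move/Lfun_momentP => -[]. Qed.

Lemma LfunD_fun f g : f \in Lp -> g \in Lp -> (fun w => f w + g w) \in Lp.
Proof.
move=> fp gp; have := (Lfun_submod_closed P p1).2 1 f g fp gp.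
by rewrite scale1r.
Qed.

Lemma LfunZ_fun (a : R) f : f \in Lp -> (fun w => a * f w) \in Lp.
Proof.
move=> fp; have [z /(_ a f 0 fp z)] := Lfun_submod_closed P p1.
by rewrite addr0.
Qed.

Lemma LfunB_fun f g : f \in Lp -> g \in Lp -> (fun w => f w - g w) \in Lp.
Proof.
move=> fp gp; have := (Lfun_submod_closed P p1).2 (-1) g f gp fp.
rewrite (_ : -1 *: g + f = fun w => f w - g w)//; apply/funext => w.
by rewrite scaleN1r fctE addrC.
Qed.

Lemma le_Lfun (f g : T -> R) : measurable_fun setT f -> g \in Lp ->
  {ae P, forall w, `|f w| <= `|g w|} -> f \in Lp.
Proof.
move=> mf gp fg; apply/Lfun_momentP; split => //.
by apply: le_lt_trans (Lfun_moment_lty gp); exact: le_moment (Lfun_measurable gp) fg.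
Qed.

Lemma Lfun_integrable1 f : f \in Lp -> P.-integrable setT (EFin \o f).
Proof.
move=> fp; apply/Lfun1_integrable.
by apply: (Lfun_subset _ p1 _ p1) fp => //; rewrite ?fin_num_measure.
Qed.

Variable rho : LspaceType P p1 -> R.
Hypotheses (rho_cvx : rho_convex rho) (rho_mono : rho_nondecreasing rho)
  (rho_law : law_invariant rho).

(* [rho] on functions, with junk value [0] outside of L^p. *)
Definition rho_fun (f : T -> R) : R :=
  match pselect (f \in Lp) with
  | left h => rho (Lclass (Lfun_Sub p1 h)) | right _ => 0 end.

Lemma rho_funE f (h : f \in Lp) : rho_fun f = rho (Lclass (Lfun_Sub p1 h)).
Proof.
by rewrite /rho_fun; case: pselect => // h'; rewrite (bool_irrelevance h h').
Qed.

Lemma rho_fun_convex (t : R) f g : 0 <= t <= 1 -> f \in Lp -> g \in Lp ->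
  rho_fun (fun w => t * f w + (1 - t) * g w) <=
  t * rho_fun f + (1 - t) * rho_fun g.
Proof.
move=> t01 fp gp.
have fgp : (fun w => t * f w + (1 - t) * g w) \in Lp.
  by apply: LfunD_fun; exact: LfunZ_fun.
(* The weights in [convex_function] range over [{i01 R}], so [t] is packed together with its
   bounds. *)
have ti : Itv.spec (@Itv.num_sem R) (Itv.Real `[0%Z, 1%Z]) t.
  by apply/and3P; split; rewrite ?num_real// bnd_simp; case/andP: t01.
pose u : {i01 R} := Itv.mk ti.
rewrite !rho_funE; have := rho_cvx u (mem_set I : Lfun_Sub p1 fp \in setT)
  (mem_set I : Lfun_Sub p1 gp \in setT).
congr (rho (Lclass _) <= _).
by apply/LfuneqP => w.
Qed.

Lemma rho_fun_mono (f g : T -> R) : f \in Lp -> g \in Lp ->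
  {ae P, forall w, f w <= g w} -> rho_fun f <= rho_fun g.
Proof.
move=> fp gp fg; rewrite !rho_funE; apply: rho_mono.
have := LclassE (Lfun_Sub p1 gp); have := LclassE (Lfun_Sub p1 fp).
apply: filterS3 fg => w h h1 h2; rewrite h1 ?h2//; exact: h.
Qed.

Lemma rho_fun_law (f g : T -> R) : f \in Lp -> g \in Lp ->
  (forall A : set R, measurable A -> P (f @^-1` A) = P (g @^-1` A)) ->
  rho_fun f = rho_fun g.
Proof.
move=> fp gp fg; rewrite !rho_funE; apply: rho_law => A mA.
(* The representative of a class differs from [h] on a null set only, hence has the same law. *)
have e (h : LfunType P p1) : P ((Lclass h : T -> R) @^-1` A) = P (h @^-1` A).
  apply: ae_eq_preimage => //.
    exact: (measurable_funPT (repr (Lclass_mfun h))).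
  by have := LclassE h; apply: filterS => w; exact.
rewrite /pushforward !e; exact: fg.
Qed.

End Lp_moment.
(** * Continuity of convex monotone functionals *)

Section convex_mono_continuous.
Context d (T : measurableType d) (R : realType) (P : probability T R).
Variables (p : R) (p1 : (1 <= p%:E)%E).
Local Notation Lp := (Lfun P p%:E).
Variable phi : (T -> R) -> R.
Hypothesis phi_convex : forall (t : R) f g, 0 <= t <= 1 -> f \in Lp -> g \in Lp ->
  phi (fun w => t * f w + (1 - t) * g w) <= t * phi f + (1 - t) * phi g.
Hypothesis phi_mono : forall f g : T -> R, f \in Lp -> g \in Lp ->
  {ae P, forall w, f w <= g w} -> phi f <= phi g.

Let p_ge1 : 1 <= p. Proof. by rewrite -lee_fin. Qed.
Let p_gt0 : 0 < p. Proof. exact: lt_le_trans p_ge1. Qed.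

(** Take for [Z] the [p]-th root of the sum [S] of all [(n+1)^p |D n|^p]. The hypothesis bounds the
    integral of the [n]-th term by [2^-(n+1)], so [S] has integral at most 1, and every single term
    is below [S]. *)
Lemma Lfun_envelope (D : (T -> R)^nat) :
  (forall n, measurable_fun setT (D n)) ->
  (forall n, (moment P p (D n) < (2^-1 ^+ n.+1 / n.+1%:R `^ p)%:E)%E) ->
  exists2 Z, Z \in Lp &
    {ae P, forall w, forall n, n.+1%:R * `|D n w| <= Z w}.
Proof.
move=> mD mmD.
pose s n w := n.+1%:R `^ p * `|D n w| `^ p.
have s0 n w : 0 <= s n w by rewrite mulr_ge0 ?powR_ge0.
have ms n : measurable_fun setT (s n).
  by apply: measurable_funM => //; exact: measurable_fun_norm_powR.
pose S w : \bar R := (\sum_(0 <= n <oo) (s n w)%:E)%E.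
have S0 w : (0 <= S w)%E by apply: nneseries_ge0 => n _ _; rewrite lee_fin.
have mS : measurable_fun setT S.
  apply: ge0_emeasurable_sum => [n w _ _|n _]; first by rewrite lee_fin.
  exact/measurable_EFinP.
have intS : (\int[P]_w S w <= 1)%E.
  rewrite integral_nneseries//; first last.
  - by move=> n w _; rewrite lee_fin.
  - by move=> n; exact/measurable_EFinP.
  apply: le_trans (epsilon_trick0 xpredT ler01); apply: lee_nneseries.
    by move=> n _ _; apply: integral_ge0 => w _; rewrite lee_fin.
  move=> n _; rewrite (ge0_integralZl_EFin_fun P
    (measurable_fun_norm_powR p (mD n)) (fun=> powR_ge0 _ _) (powR_ge0 _ _)).
  have n0 : 0 < n.+1%:R `^ p :> R by rewrite powR_gt0.
  rewrite muleC -lee_pdivlMr//.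
  by apply: le_trans (ltW (mmD n)) _; rewrite -EFinM lee_fin natrX exprVn div1r.
pose Z w := fine (S w) `^ p^-1.
have mZ : measurable_fun setT Z.
  apply: (measurableT_comp (measurable_powR _)).
  exact: (measurableT_comp _ mS).
have ZE w : `|Z w| `^ p = fine (S w).
  rewrite ger0_norm ?powR_ge0// /Z -powRrM mulVf ?gt_eqF// powRr1// fine_ge0//.
exists Z.
  apply/(Lfun_momentP _ p1); split => //; rewrite /moment.
  under eq_integral do rewrite ZE.
  apply: (@le_lt_trans _ _ 1%E); last by rewrite ltry.
  apply: le_trans intS; apply: ge0_le_integral => //.
  - by move=> w _; rewrite lee_fin fine_ge0.
  - by apply/measurable_EFinP; exact: (measurableT_comp _ mS).
  - by move=> w _; case: (S w) (S0 w) => [r| |]//= _; rewrite leey.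
(* [fine] sends [+oo] to [0], so [Z] dominates only where [S] is finite; integrability makes this
   almost everywhere. *)
have iS : P.-integrable setT S.
  apply/integrableP; split => //.
  under eq_integral do rewrite gee0_abs//.
  by apply: le_lt_trans intS _; rewrite ltry.
apply: filterS (integrable_ae measurableT iS) => w /(_ I) Sfin n.
have snS : s n w <= fine (S w).
  rewrite -lee_fin fineK//.
  apply: le_trans (nneseries_lim_ge n.+1 _); last by move=> k _ _; rewrite lee_fin.
  rewrite big_nat_recr//= leeDr// sume_ge0// => k _; by rewrite lee_fin.
have -> : n.+1%:R * `|D n w| = (s n w) `^ p^-1.
  by rewrite /s -powRM// -powRrM mulfV ?gt_eqF// powRr1// mulr_ge0.
by rewrite ge0_ler_powR ?nnegrE ?invr_ge0 ?fine_ge0// ltW.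
Qed.

(** If no [eta] works, there are counterexamples [Y n] whose moments decrease as fast as
    [Lfun_envelope] demands. Convexity along the envelope [Z] then gives
    [(n+1) |phi (Y n) - phi X| <= c] with [c] independent of [n], which contradicts
    [eps <= |phi (Y n) - phi X|] for large [n]. *)
Lemma convex_mono_continuous X (eps : R) : X \in Lp -> 0 < eps ->
  exists2 eta : R, 0 < eta & forall Y, Y \in Lp ->
    (moment P p (fun w => Y w - X w)%R < eta%:E)%E -> `|phi Y - phi X| < eps.
Proof.
move=> Xp eps0; apply: contrapT => noeta.
have exY n : exists Y, [/\ Y \in Lp,
    (moment P p (fun w => Y w - X w)%R < (2^-1 ^+ n.+1 / n.+1%:R `^ p)%:E)%E &
    eps <= `|phi Y - phi X|].
  apply: contrapT => noY; apply: noeta.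
  exists (2^-1 ^+ n.+1 / n.+1%:R `^ p).
    by rewrite divr_gt0 ?powR_gt0// exprn_gt0// invr_gt0.
  move=> Y Yp YX; rewrite ltNge; apply/negP => YXe; apply: noY; exists Y; split => //.
have [Y hY] := choice exY.
have Yp n : Y n \in Lp by have [] := hY n.
have [n|n|Z Zp YXZ] := Lfun_envelope (D := fun n w => Y n w - X w).
- exact/(Lfun_measurable p1)/(LfunB_fun p1).
- by have [] := hY n.
have XZp := LfunD_fun p1 Xp Zp.
pose c := phi (fun w => X w + Z w) - phi X.
have Nc n : n.+1%:R * `|phi (Y n) - phi X| <= c.
  have N0 : 0 < n.+1%:R :> R by rewrite ltr0n.
  (* Since [(n+1) (Y n - X) <= Z], [Y n] lies below the combination of [X + Z] and [X] with weight
     [1/(n+1)] on [X + Z]. *)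
  have upper : n.+1%:R * (phi (Y n) - phi X) <= c.
    have t01 : 0 <= (n.+1%:R : R)^-1 <= 1.
      by rewrite invr_ge0 ler0n invf_le1// ler1n.
    have le1 := phi_convex t01 XZp Xp.
    have : phi (Y n) <= n.+1%:R^-1 * phi (fun w => X w + Z w) +
        (1 - n.+1%:R^-1) * phi X.
      apply: le_trans le1; apply: phi_mono => //.
        by apply: (LfunD_fun p1); exact: (LfunZ_fun p1).
      apply: filterS YXZ => w /(_ n) h.
      have : n.+1%:R * (Y n w - X w) <= Z w.
        by apply: le_trans h; rewrite ler_pM2l// ler_norm.
      have k0 : 0 < n.+1%:R^-1 :> R by rewrite invr_gt0.
      rewrite -(ler_pM2l k0) mulKf ?gt_eqF//; move: (n.+1%:R^-1 : R) => k; lra.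
    have k0 : 0 < n.+1%:R^-1 :> R by rewrite invr_gt0.
    rewrite -[n.+1%:R * _ <= _](ler_pM2l k0) mulKf ?gt_eqF// /c.
    by move: (n.+1%:R^-1 : R) => k; lra.
  (* Here [X] lies below a combination of [X + Z] and [Y n]. The weight is [1/(n+2)]: after
     multiplication by [n+2] the claim reads [(n+2) X <= X + Z + (n+1) Y n]. *)
  have lower : n.+1%:R * (phi X - phi (Y n)) <= c.
    have M0 : 0 < n.+2%:R :> R by rewrite ltr0n.
    have N2 : n.+2%:R = n.+1%:R + 1 :> R by rewrite natr1.
    have ME a b : n.+2%:R * (n.+2%:R^-1 * a + (1 - n.+2%:R^-1) * b) =
        a + n.+1%:R * b :> R.
      rewrite mulrDr mulVKf ?gt_eqF// mulrA mulrBr divff ?gt_eqF// mulr1.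
      by rewrite N2 addrK.
    have t01 : 0 <= (n.+2%:R : R)^-1 <= 1.
      by rewrite invr_ge0 ler0n invf_le1// ler1n.
    have le1 := phi_convex t01 XZp (Yp n).
    have : phi X <= n.+2%:R^-1 * phi (fun w => X w + Z w) +
        (1 - n.+2%:R^-1) * phi (Y n).
      apply: le_trans le1; apply: phi_mono => //.
        by apply: (LfunD_fun p1); exact: (LfunZ_fun p1).
      apply: filterS YXZ => w /(_ n) h.
      have : n.+1%:R * (X w - Y n w) <= Z w.
        by apply: le_trans h; rewrite ler_pM2l// -normrN opprB ler_norm.
      by rewrite -[X w <= _](ler_pM2l M0) ME N2; move: (n.+1%:R : R) => N; lra.
    by rewrite -(ler_pM2l M0) ME N2 /c; move: (n.+1%:R : R) => N; lra.
  by have [_|_] := ler0P (phi (Y n) - phi X); rewrite ?opprB.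
pose n := Num.truncn (c / eps).
have := Nc n; have [_ _ hn] := hY n.
apply/negP; rewrite -ltNge; apply: (@lt_le_trans _ _ (n.+1%:R * eps)).
  by rewrite -ltr_pdivrMr// truncnS_gt.
by rewrite ler_pM2l.
Qed.

End convex_mono_continuous.

(** * Test functions and quantiles *)

Section growth_functions.
Context (R : realType) (p : R).
Hypothesis p1 : 1 <= p.
Let p_gt0 : 0 < p. Proof. exact: lt_le_trans p1. Qed.

(** The supremum topology is finer than the initial topology of each of its test integrals. *)
Lemma Rintegral_growth_fun_continuous (g : growth_fun p) :
  continuous (fun mu : moment_probability p => Rintegral mu [set: R] g).
Proof.
move=> mu A nA.
pose Tc (g' : growth_fun p) := Topological.class (initial_topology
  (fun nu : moment_probability p => Rintegral nu [set: R] g')).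
have /(cvg_sup Tc)/(_ g) : nbhs mu --> (mu : sup_topology Tc) by exact: cvg_id.
apply; exact: (@initial_continuous _ _ (fun nu : moment_probability p =>
  Rintegral nu [set: R] g) mu).
Qed.

Lemma maxr0_powR_continuous : continuous (fun y : R => Num.max 0 y `^ p).
Proof.
move=> y; have [y0|y0|->] := ltgtP y 0.
- rewrite /continuous_at max_l ?ltW// powR0 ?gt_eqF//; apply: cvg_near_cst.
  near=> z; have z0 : z < 0 by near: z; exact: (lt_nbhsl y0).
  by rewrite max_l ?ltW// powR0// gt_eqF.
- have cy : {for y, continuous (fun z : R => z `^ p)}.
    apply: differentiable_continuous; apply/derivable1_diffP.
    by apply: derivable_powR; rewrite in_itv/= y0.
  rewrite /continuous_at max_r ?ltW//; apply: cvg_trans cy.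
  apply: near_eq_cvg; near=> z.
  have z0 : 0 < z by near: z; exact: (lt_nbhsr y0).
  by rewrite max_r ?ltW.
(* At [0], [1 <= p] gives [z ^ p <= z < e] for [0 < z < min 1 e]. *)
- rewrite /continuous_at maxxx powR0 ?gt_eqF//; apply/cvgrPdist_lt => e e0.
  have oe : 0 < Num.min 1 e by rewrite lt_min ltr01.
  near=> z; rewrite sub0r normrN ger0_norm ?powR_ge0//.
  have [z0|z0] := leP z 0; first by rewrite powR0// gt_eqF.
  have : z < Num.min 1 e by near: z; exact: lt_nbhsl.
  rewrite lt_min => /andP[z1]; apply: le_lt_trans.
  by rewrite ge1r_powR// z0/= ltW.
Unshelve. all: end_near. Qed.

(** For [0 <= M] this is the [p]-th power of the distance from [t] to its truncation [clamp M t],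
    see [norm_sub_clamp]. It is continuous with growth of order [p], so the truncation error of a
    quantile is an admissible test integral. *)
Definition tail (M t : R) : R := Num.max 0 (`|t| - M) `^ p.

Lemma tail_ge0 M t : 0 <= tail M t. Proof. exact: powR_ge0. Qed.

Lemma tail_le M t : 0 <= M -> tail M t <= `|t| `^ p.
Proof.
move=> M0; rewrite ge0_ler_powR ?nnegrE ?(ltW p_gt0)//; first by rewrite le_max lexx.
by rewrite ge_max normr_ge0 gerBl.
Qed.

Lemma tail_continuous M : continuous (tail M).
Proof.
move=> t; apply: (@continuous_comp _ _ _ (fun t : R => `|t| - M)
  (fun y => Num.max 0 y `^ p)); last exact: maxr0_powR_continuous.
by apply: cvgB; [exact: norm_continuous|exact: cvg_cst].
Qed.

Lemma tail_growth M : 0 <= M ->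
  has_ubound (range (fun y => `|tail M y| / (1 + `|y| `^ p))).
Proof.
move=> M0; exists 1 => _ [y _ <-].
rewrite ler_pdivrMr ?ltr_wpDr ?powR_ge0// mul1r ger0_norm ?tail_ge0//.
by apply: le_trans (tail_le _ M0) _; rewrite lerDr.
Qed.

Definition ramp (a b t : R) : R := Num.max 0 (Num.min 1 ((t - a) / (b - a))).

Lemma ramp_ge0 a b t : 0 <= ramp a b t. Proof. by rewrite le_max lexx. Qed.

Lemma ramp_le1 a b t : ramp a b t <= 1.
Proof. by rewrite ge_max ler01 ge_min lexx. Qed.

Lemma ramp0 a b t : a < b -> t <= a -> ramp a b t = 0.
Proof.
move=> ab ta; apply/max_idPl; rewrite ge_min; apply/orP; right.
by rewrite pmulr_lle0 ?subr_le0// invr_gt0 subr_gt0.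
Qed.

Lemma ramp1 a b t : a < b -> b < t -> ramp a b t = 1.
Proof.
move=> ab bt; have : 1 <= (t - a) / (b - a).
  by rewrite ler_pdivlMr ?subr_gt0// mul1r lerB// ltW.
by rewrite /ramp => /min_idPl ->; apply/max_idPr.
Qed.

Lemma ramp_continuous a b : continuous (ramp a b).
Proof.
move=> t; apply: (@continuous_max _ _ (cst (0:R))
  (fun t => Num.min 1 ((t - a) / (b - a)))); first exact: cvg_cst.
apply: (@continuous_min _ _ (cst 1) (fun t => (t - a) / (b - a))).
  exact: cvg_cst.
by apply: cvgM; [apply: cvgB; [exact: cvg_id|exact: cvg_cst]|exact: cvg_cst].
Qed.

Lemma ramp_growth a b :
  has_ubound (range (fun y => `|ramp a b y| / (1 + `|y| `^ p))).
Proof.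
exists 1 => _ [y _ <-].
rewrite ler_pdivrMr ?ltr_wpDr ?powR_ge0// mul1r ger0_norm ?ramp_ge0//.
by apply: le_trans (ramp_le1 _ _ _) _; rewrite lerDl powR_ge0.
Qed.

Definition clamp (M t : R) : R := Num.max (- M) (Num.min t M).

Lemma clamp_itv M t : 0 <= M -> - M <= clamp M t <= M.
Proof. by move=> M0; rewrite le_max lexx/= ge_max ge_min lexx orbT andbT; lra. Qed.

Lemma clamp_homo M : {homo clamp M : x y / x <= y}.
Proof.
move=> x y xy; rewrite ge_max !le_max lexx/=; apply/orP; right.
by rewrite le_min !ge_min xy lexx orbT.
Qed.

Lemma clamp_ltr M x s : - M <= x -> x < clamp M s -> x < s.
Proof. by move=> Mx; rewrite lt_max lt_min => /orP[|/andP[]//]; lra. Qed.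

Lemma clamp_ler M x s : x < M -> clamp M s <= x -> s <= x.
Proof. by move=> Mx; rewrite ge_max ge_min => /andP[_ /orP[//|]]; lra. Qed.

Lemma norm_sub_clamp M t : 0 <= M -> `|t - clamp M t| `^ p = tail M t.
Proof.
move=> M0; congr (_ `^ _); rewrite /clamp.
have [tM|tM] := leP t M; have [?|?] := leP (- M) _; rewrite ?subrr ?normr0.
- by apply/esym/max_idPl; rewrite subr_le0 ler_norml; lra.
- have t0 : t < 0 by lra.
  rewrite opprK ltr0_norm; last by lra.
  by rewrite ltr0_norm// max_r; lra.
- have t0 : 0 < t by lra.
  by rewrite gtr0_norm ?subr_gt0// gtr0_norm// max_r//; lra.
- by lra.
Qed.

Lemma clamp_continuous M : continuous (clamp M).
Proof.
move=> t; apply: (@continuous_max _ _ (cst (- M)) (fun t => Num.min t M)).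
  exact: cvg_cst.
by apply: (@continuous_min _ _ id (cst M)); [exact: cvg_id|exact: cvg_cst].
Qed.

Lemma measurable_clamp M : measurable_fun setT (clamp M).
Proof. by apply: continuous_measurable_fun; exact: clamp_continuous. Qed.

End growth_functions.

(** A gap of more than two mesh widths contains a whole cell of the grid that divides [[-M, M]] into
    [N] parts. *)
Lemma grid_gap (R : realType) (M : R) (N : nat) (s t : R)
    (h := 2 * M / N%:R) : 0 < M -> (0 < N)%N ->
  clamp M s + 2 * h < clamp M t ->
  exists i : 'I_N, s <= - M + i%:R * h /\ - M + i.+1%:R * h < t.
Proof.
move=> M0 N0 st.
have N0' : 0 < N%:R :> R by rewrite ltr0n.
have h0 : 0 < h by rewrite divr_gt0// mulr_gt0.
have Nh : N%:R * h = 2 * M by rewrite mulrC divfK// gt_eqF.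
have /andP[Ms _] := clamp_itv s (ltW M0); have /andP[_ tM] := clamp_itv t (ltW M0).
(* [clamp M s] lies in grid cell [j]; cell [j + 1] starts to its right and, the gap exceeding
   [2 * h], ends before [clamp M t]. Both ends of that cell lie in [[-M, M[], where the comparison
   survives removal of the clamp. *)
pose j := Num.truncn ((clamp M s + M) / h).
have j1 : clamp M s + M < j.+1%:R * h by rewrite -ltr_pdivrMr// truncnS_gt.
have j2 : j%:R * h <= clamp M s + M.
  rewrite -ler_pdivlMr// truncn_le// divr_ge0 ?(ltW h0)//; lra.
have E1 : j.+1%:R = j%:R + 1 :> R by rewrite natr1.
have E2 : j.+2%:R = j%:R + 2 :> R by rewrite -natrD addn2.
have jt : - M + j.+2%:R * h < clamp M t by rewrite E2; lra.
have jN : (j.+1 < N)%N.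
  by rewrite -(ltr_nat R) -(ltr_pM2r h0) Nh; move: jt; rewrite E1 E2; lra.
have jp : 0 <= j%:R * h by rewrite mulr_ge0// ltW.
exists (Ordinal jN) => /=; split.
- apply: (@clamp_ler _ M); last by lra.
  by move: jt; rewrite E1 E2; lra.
- by apply: clamp_ltr jt; rewrite lerDl E2; lra.
Qed.

(** Either the truncated values are within [2 * h], or some grid cell separates [s] from [t]; then
    the sum is at least 1, and the distance never exceeds [2 * M]. At two quantiles the summands
    become indicators of [crossing] events, which [le_crossing] controls. *)
Lemma clamp_dist_powR_le (R : realType) (p M : R) (N : nat) (s t : R)
    (h := 2 * M / N%:R) (x := fun i : nat => - M + i%:R * h) :
  1 <= p -> 0 < M -> (0 < N)%N ->
  `|clamp M s - clamp M t| `^ p <= (2 * h) `^ p + (2 * M) `^ p *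
    \sum_(i < N) (((s <= x i) && (x i.+1 < t))%:R + ((t <= x i) && (x i.+1 < s))%:R).
Proof.
move=> p1 M0 N0.
have p0 : 0 <= p by lra.
have N0' : 0 < N%:R :> R by rewrite ltr0n.
have h0 : 0 < h by rewrite divr_gt0// mulr_gt0.
pose c i : R := ((s <= x i) && (x i.+1 < t))%:R + ((t <= x i) && (x i.+1 < s))%:R.
have c0 i : 0 <= c i by rewrite addr_ge0// ler0n.
have sum0 : 0 <= \sum_(i < N) c i by exact: sumr_ge0.
have sM := clamp_itv s (ltW M0); have tM := clamp_itv t (ltW M0).
have le2M : `|clamp M s - clamp M t| <= 2 * M by rewrite ler_norml; lra.
have [st|st] := leP `|clamp M s - clamp M t| (2 * h).
  apply: (@le_trans _ _ ((2 * h) `^ p)); last by rewrite lerDl mulr_ge0 ?powR_ge0.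
  by rewrite ge0_ler_powR ?nnegrE// mulr_ge0// ltW.
have [i ci] : exists i : 'I_N, 1 <= c i.
  move: st; rewrite ltr_normr => /orP[] st.
    have [|i [ti si]] := @grid_gap R M N t s M0 N0; first by rewrite -/h; lra.
    by exists i; rewrite /c ti si lerDr ler0n.
  have [|i [si ti]] := @grid_gap R M N s t M0 N0; first by rewrite -/h; lra.
  by exists i; rewrite /c ti si lerDl ler0n.
apply: (@le_trans _ _ ((2 * M) `^ p)).
  by rewrite ge0_ler_powR ?nnegrE// mulr_ge0// ltW.
rewrite ler_wpDl ?powR_ge0// -[leLHS]mulr1 ler_wpM2l ?powR_ge0//.
by rewrite (le_trans ci)// (bigD1 i)//= lerDl sumr_ge0.
Qed.

(** * Continuity of the quantile coupling into L^p *)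

Section quantile_uniform.
Context d (T : measurableType d) (R : realType) (P : probability T R).
Variables (p : R) (p1 : (1 <= p%:E)%E) (U : {RV P >-> R}).
Hypotheses (U01 : uniform01 U) (Uoo : forall w, 0 < U w < 1).
Implicit Types mu nu : moment_probability p.

Let p_ge1 : 1 <= p. Proof. by rewrite -lee_fin. Qed.
Let p_gt0 : 0 < p. Proof. exact: lt_le_trans p_ge1. Qed.

Local Notation Q mu := (fun w => quantile mu (U w)).

Lemma quantile_homo (mu : probability R R) s t : 0 < s -> s <= t -> t < 1 ->
  quantile mu s <= quantile mu t.
Proof.
move=> s0 st t1; rewrite quantile_le; last by rewrite s0 (le_lt_trans st).
by rewrite (le_trans st)// -quantile_le ?lexx// (lt_le_trans s0).
Qed.

Lemma measurable_quantile_rv (mu : probability R R) : measurable_fun setT (Q mu).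
Proof.
have mq : measurable_fun setT (quantile mu) by exact: quantile_measurable.
by apply: (measurableT_comp mq).
Qed.

Lemma quantile_rv_Lfun mu : Q mu \in Lfun P p%:E.
Proof. exact: quantile_Lfun. Qed.

Lemma ge0_integral_quantile (mu : probability R R) (f : R -> R) :
  measurable_fun setT f -> (forall t, 0 <= f t) ->
  (\int[P]_w (f (quantile mu (U w)))%:E = \int[mu]_t (f t)%:E)%E.
Proof.
move=> mf f0.
have mEf : measurable_fun setT (EFin \o f) by exact/measurable_EFinP.
have Ef0 t : (0 <= (EFin \o f) t)%E by rewrite lee_fin.
pose X : {RV P >-> R} := (quantile mu \o U) : {RV P >-> R}.
transitivity (\int[distribution P X]_t (f t)%:E)%E.
  exact/esym/(ge0_integral_distribution X mEf Ef0).
by apply: eq_measure_integral => A mA _; exact: quantile_distribution.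
Qed.

(** The growth bound makes the integral finite, so the real-valued [Rintegral] loses nothing. *)
Lemma ge0_integral_moment_probability_fin mu (f : R -> R) :
  measurable_fun setT f -> (forall t, 0 <= f t) ->
  (exists C, forall t, f t <= C + `|t| `^ p) ->
  (Rintegral mu setT f)%:E = (\int[mu]_t (f t)%:E)%E.
Proof.
move=> mf f0 [C fC].
have i0 : (0 <= \int[mu]_t (f t)%:E)%E by apply: integral_ge0 => t _; rewrite lee_fin.
rewrite /Rintegral fineK// ge0_fin_numE//.
have mp : measurable_fun setT (fun t : R => `|t| `^ p).
  by apply: measurable_fun_norm_powR; exact: measurable_id.
have fC' t : f t <= `|C| + `|t| `^ p by rewrite (le_trans (fC t))// lerD2r ler_norm.
apply: (@le_lt_trans _ _ (\int[mu]_t (`|C| + `|t| `^ p)%:E)%E).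
  apply: ae_ge0_le_integral_EFin => //.
  - exact: measurable_funD.
  - exact: (aeW mu fC').
rewrite ge0_integralD_EFin//.
rewrite (integral_cst mu measurableT `|C|%:E) lte_add_pinfty//.
  by rewrite -ge0_fin_numE ?fin_numM ?fin_num_measure// mule_ge0.
exact: moment_probability_fin.
Qed.

Lemma measurable_ramp a b : measurable_fun setT (@ramp R a b).
Proof. by apply: continuous_measurable_fun; exact: ramp_continuous. Qed.

#[local] Hint Resolve measurable_ramp : core.

Lemma EFin_Rintegral_ramp mu a b :
  (Rintegral mu setT (ramp a b))%:E = (\int[mu]_t (ramp a b t)%:E)%E.
Proof.
apply: ge0_integral_moment_probability_fin => //; first exact: ramp_ge0.
by exists 1 => t; rewrite (le_trans (ramp_le1 _ _ _))// lerDl powR_ge0.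
Qed.

Lemma measurable_tail M : measurable_fun setT (@tail R p M).
Proof. by apply: continuous_measurable_fun; exact: tail_continuous. Qed.

#[local] Hint Resolve measurable_tail : core.

Lemma EFin_Rintegral_tail mu M : 0 <= M ->
  (Rintegral mu setT (tail p M))%:E = (\int[mu]_t (tail p M t)%:E)%E.
Proof.
move=> M0; apply: ge0_integral_moment_probability_fin => //; first exact: tail_ge0.
by exists 0 => t; rewrite add0r tail_le.
Qed.

Definition crossing (mu nu : probability R R) (a b : R) : set T :=
  [set w | quantile mu (U w) <= a /\ b < quantile nu (U w)].

Lemma measurable_crossing mu nu a b : measurable (crossing mu nu a b).
Proof.
have -> : crossing mu nu a b =
    (Q mu @^-1` `]-oo, a]%classic) `&` (Q nu @^-1` `]b, +oo[%classic).
  by apply/seteqP; split => w /=; rewrite !in_itv/= ?andbT.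
by apply: measurableI; rewrite -[X in measurable X]setTI; exact: measurable_quantile_rv.
Qed.

(* If the crossing occurs at [U w0], then monotonicity forces [ramp] to vanish
   at [quantile mu] on the left of [U w0], and to be [1] at [quantile nu] on the
   right of it. *)
Lemma le_crossing mu nu a b : a < b ->
  (P (crossing mu nu a b) <=
   `|Rintegral nu setT (ramp a b) - Rintegral mu setT (ramp a b)|%:E)%E.
Proof.
move=> ab; have [->|/set0P[w0 [mu0 nu0]]] := eqVneq (crossing mu nu a b) set0.
  by rewrite measure0.
have mE := measurable_crossing mu nu a b.
suff : (P (crossing mu nu a b) + (Rintegral mu setT (ramp a b))%:E <=
        (Rintegral nu setT (ramp a b))%:E)%E.
  rewrite -leeBrDr// => /le_trans; apply.
  by rewrite -EFinB lee_fin ler_norm.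
rewrite !EFin_Rintegral_ramp -!ge0_integral_quantile//; [|by move=> t; exact: ramp_ge0..].
rewrite -[crossing _ _ _ _]setIT -integral_indic//.
have mr (m : moment_probability p) :
    measurable_fun setT (fun w => ramp a b (quantile m (U w))).
  exact: (measurableT_comp (measurable_ramp a b) (measurable_quantile_rv m)).
rewrite -ge0_integralD_EFin//; last by move=> w; exact: ramp_ge0.
apply: ae_ge0_le_integral_EFin => //.
- exact: measurable_funD.
- by move=> w; rewrite addr_ge0 ?ramp_ge0.
- by move=> w; exact: ramp_ge0.
apply: aeW => w; rewrite indicE.
have [/[!inE] -[muw nuw]|wE] := boolP (w \in crossing mu nu a b).
  by rewrite ramp0// ramp1// addr0.
rewrite add0r; have /andP[Uw0 Uw1] := Uoo w; have /andP[U0 U1] := Uoo w0.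
have [ww0|/ltW ww0] := leP (U w) (U w0).
  rewrite (@ramp0 _ a b (quantile mu (U w)))// ?ramp_ge0//.
  by rewrite (le_trans _ mu0)// quantile_homo.
rewrite (@ramp1 _ a b (quantile nu (U w)))// ?ramp_le1//.
by rewrite (lt_le_trans nu0)// quantile_homo.
Qed.

(** Dominated convergence with dominating function [|t|^p]: at a fixed [t] the tail vanishes as soon
    as [M] exceeds [|t|]. *)
Lemma tail_small mu (e : R) : 0 < e ->
  exists2 M : R, 0 < M & (Rintegral mu setT (tail p M) < e).
Proof.
move=> e0.
have mp : measurable_fun setT (fun t : R => `|t| `^ p).
  by apply: measurable_fun_norm_powR; exact: measurable_id.
have ip : mu.-integrable setT (fun t : R => (`|t| `^ p)%:E).
  apply/integrableP; split; first exact/measurable_EFinP.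
  apply: le_lt_trans (moment_probability_fin mu).
  by under eq_integral do rewrite gee0_abs ?lee_fin ?powR_ge0//.
pose f_ (n : nat) t := (tail p n.+1%:R t)%:E.
have mf n : measurable_fun setT (f_ n) by exact/measurable_EFinP.
have cf : {ae mu, forall t, setT t -> f_ n t @[n --> \oo] --> (cst 0%E t : \bar R)}.
  apply: aeW => t _; apply: cvg_near_cst; exists (Num.truncn `|t|) => // n /= tn.
  congr EFin; rewrite /tail max_l ?powR0 ?gt_eqF// subr_le0.
  by rewrite (le_trans (ltW (truncnS_gt _)))// ler_nat.
have bf : {ae mu, forall t, forall n, setT t -> (`|f_ n t| <= (`|t| `^ p)%:E)%E}.
  by apply: aeW => t n _; rewrite gee0_abs ?lee_fin ?tail_ge0// tail_le.
have [_ _] := dominated_convergence measurableT mf (measurable_cst _) cf ip bf.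
rewrite integral_cst// mul0e => /fine_cvg.
rewrite /= => /cvgrPdist_lt/(_ e e0) [n _ /(_ n (leqnn n))].
rewrite sub0r normrN => h; exists n.+1%:R; rewrite ?ltr0n//.
exact: le_lt_trans (ler_norm _) h.
Qed.

Lemma near_Rintegral_growth mu (g : growth_fun p) (e : R) : 0 < e ->
  \forall nu \near mu,
    `|Rintegral (nu : moment_probability p) setT g - Rintegral mu setT g| < e.
Proof.
move=> e0; have := @Rintegral_growth_fun_continuous R p g mu.
by move=> /cvgrPdist_lt/(_ e e0); apply: filterS => nu; rewrite distrC.
Qed.

(** Write [X - Y] as [X - clamp X], plus [clamp X - clamp Y], plus [clamp Y - Y]. The outer terms
    are tails; the middle one is bounded through a grid by crossing probabilities. Finitely many
    test functions suffice: one tail and [N] ramps. *)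
Lemma near_quantile mu (e : R) : 0 < e ->
  \forall nu \near mu,
    (moment P p (fun w => quantile (nu : moment_probability p) (U w) - quantile mu (U w))%R
      < e%:E)%E.
Proof.
move=> e0; pose K := 2 `^ p : R.
have K1 : 1 <= K by rewrite /K -[leLHS](powRr0 2) ler_powR// ?ler1n// ltW.
have K0 : 0 < K by exact: lt_le_trans K1.
(* Each of the three pieces gets at most [e1]; two uses of [momentD_le] give
   [K (e1 + 2 K e1) <= 3 K^2 e1 < e]. *)
pose e1 := e / (4 * K ^+ 2).
have e10 : 0 < e1 by rewrite divr_gt0// mulr_gt0 ?exprn_gt0.
have [M M0 tmu] := tail_small mu (divr_gt0 e10 (ltr0n _ 2)).
(* With [2 * h < r <= 1], [1 <= p] gives [(2 * h) ^ p <= 2 * h < e1 / 2]. *)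
pose r := Num.min 1 (e1 / 2).
have r0 : 0 < r by rewrite lt_min ltr01 divr_gt0.
pose N := (Num.truncn (4 * M / r)).+1.
have N0 : 0 < N%:R :> R by rewrite ltr0n.
pose h := 2 * M / N%:R.
have h0 : 0 < h by rewrite divr_gt0// mulr_gt0.
have hr : 2 * h < r.
  rewrite (_ : 2 * h = 4 * M / N%:R); last by rewrite /h; ring.
  by rewrite ltr_pdivrMr// [r * _]mulrC -ltr_pdivrMr// truncnS_gt.
have hp : (2 * h) `^ p < e1 / 2.
  move: hr; rewrite lt_min => /andP[h1]; apply: le_lt_trans.
  by rewrite ge1r_powR// ltW// andbT mulr_gt0.
pose x (i : nat) := - M + i%:R * h.
have xS i : x i < x i.+1 by rewrite ltrD2l ltr_pM2r// ltr_nat.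
(* Two crossings for each of the [N] grid cells, weighted by [(2 * M) ^ p], then cost [e1 / 2]
   together. *)
pose dl := e1 / (4 * N%:R * (2 * M) `^ p).
have M2p : 0 < (2 * M) `^ p by rewrite powR_gt0// mulr_gt0.
have dl0 : 0 < dl by rewrite divr_gt0// mulr_gt0// mulr_gt0.
have near1 : \forall nu \near mu, forall i : 'I_N,
    `|Rintegral (nu : moment_probability p) setT (ramp (x i) (x i.+1)) -
      Rintegral mu setT (ramp (x i) (x i.+1))| < dl.
  apply: (@filter_forall _ _ _ (nbhs mu) _) => i.
  exact: (near_Rintegral_growth mu
    (GrowthFun (@ramp_continuous R (x i) (x i.+1)) (@ramp_growth R p _ _))).
have near2 := near_Rintegral_growth mu (GrowthFun (@tail_continuous R p p_ge1 M)
  (tail_growth p_ge1 (ltW M0))) (divr_gt0 e10 (ltr0n _ 2)).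
near=> nu.
have ramps : forall i : 'I_N, `|Rintegral nu setT (ramp (x i) (x i.+1)) -
    Rintegral mu setT (ramp (x i) (x i.+1))| < dl by near: nu.
have tails : `|Rintegral nu setT (tail p M) - Rintegral mu setT (tail p M)| < e1 / 2.
  by near: nu.
have tnu : Rintegral nu setT (tail p M) < e1.
  by move: tails tmu; rewrite ltr_norml => /andP[_]; lra.
pose X := Q nu; pose Y := Q mu.
have mX : measurable_fun setT X := measurable_quantile_rv nu.
have mY : measurable_fun setT Y := measurable_quantile_rv mu.
have mc : measurable_fun setT (@clamp R M) := measurable_clamp M.
have mcX : measurable_fun setT (fun w => clamp M (X w)).
  exact: (measurableT_comp mc mX).
have mcY : measurable_fun setT (fun w => clamp M (Y w)).
  exact: (measurableT_comp mc mY).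
have momX : (moment P p (fun w => X w - clamp M (X w))%R < e1%:E)%E.
  rewrite /moment; under eq_integral do rewrite norm_sub_clamp ?(ltW M0)//.
  by rewrite (ge0_integral_quantile nu (measurable_tail M) (tail_ge0 p M))
    -EFin_Rintegral_tail ?(ltW M0).
have momY : (moment P p (fun w => clamp M (Y w) - Y w)%R < e1%:E)%E.
  rewrite /moment; under eq_integral do rewrite distrC norm_sub_clamp ?(ltW M0)//.
  rewrite (ge0_integral_quantile mu (measurable_tail M) (tail_ge0 p M))
    -EFin_Rintegral_tail ?(ltW M0)//.
  by rewrite lte_fin; lra.
pose c1 i := crossing nu mu (x i) (x i.+1).
pose c2 i := crossing mu nu (x i) (x i.+1).
pose I i w : R := \1_(c1 i) w + \1_(c2 i) w.
have I0 i w : 0 <= I i w by rewrite addr_ge0// indicE ler0n.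
have mI i : measurable_fun setT (I i).
  by apply: measurable_funD; apply: measurable_indic; exact: measurable_crossing.
have mEI i : measurable_fun setT (EFin \o I i) by exact/measurable_EFinP.
have intI (i : 'I_N) : (\int[P]_w (I i w)%:E <= (2 * dl)%:E)%E.
  rewrite ge0_integralD_EFin//; first last.
  - by apply: measurable_indic; exact: measurable_crossing.
  - by apply: measurable_indic; exact: measurable_crossing.
  rewrite !integral_indic//; [|exact: measurable_crossing..].
  rewrite !setIT mulr_natl mulr2n EFinD leeD//.
    by rewrite (le_trans (le_crossing _ _ (xS i)))// lee_fin distrC ltW.
  by rewrite (le_trans (le_crossing _ _ (xS i)))// lee_fin ltW.
have momXY : (moment P p (fun w => clamp M (X w) - clamp M (Y w))%R <= e1%:E)%E.
  apply: (@le_trans _ _ (\int[P]_w ((2 * h) `^ p + (2 * M) `^ p * \sum_(i < N) I i w)%:E)%E).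
    apply: ae_ge0_le_integral_EFin.
    - by apply: measurable_fun_norm_powR; exact: measurable_funB.
    - apply: measurable_funD => //; apply: measurable_funM => //.
      exact: measurable_sum.
    - by move=> w; exact: powR_ge0.
    - by move=> w; rewrite addr_ge0 ?mulr_ge0 ?powR_ge0 ?sumr_ge0.
    apply: aeW => w.
    have := clamp_dist_powR_le (X w) (Y w) p_ge1 M0 (ltn0Sn _ : (0 < N)%N).
    move=> /le_trans; apply; rewrite lerD2l ler_wpM2l ?powR_ge0//.
    apply: ler_sum => i _; rewrite /I !indicE lerD// ler_nat.
      by case: andP => // -[? ?]; rewrite mem_set.
    by case: andP => // -[? ?]; rewrite mem_set.
  have mS : measurable_fun setT (fun w => \sum_(i < N) I i w) by exact: measurable_sum.
  have S0 w : 0 <= \sum_(i < N) I i w by exact: sumr_ge0.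
  rewrite ge0_integralD_EFin//; first last.
  - by move=> w; rewrite mulr_ge0 ?powR_ge0.
  - by move=> w; exact: powR_ge0.
  - exact: measurable_funM.
  rewrite integral_cst_probability.
  rewrite ge0_integralZl_EFin_fun ?powR_ge0//.
  under eq_integral do rewrite -sumEFin.
  rewrite ge0_integral_sum//; first last.
  - by move=> i w _; rewrite lee_fin.
  - by move=> i; exact: mEI.
  have sI : (\sum_(i < N) \int[P]_w (I i w)%:E <= (N%:R * (2 * dl))%:E)%E.
    apply: (@le_trans _ _ (\sum_(i < N) (2 * dl)%:E)%E); first exact: lee_sum.
    by rewrite sumEFin sumr_const card_ord lee_fin [leRHS]mulr_natl.
  apply: (@le_trans _ _ ((e1 / 2)%:E + ((2 * M) `^ p)%:E * (N%:R * (2 * dl))%:E)%E).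
    have hA : (((2 * h) `^ p)%:E <= (e1 / 2)%:E)%E by rewrite lee_fin ltW.
    have hB := lee_wpmul2l (ltW M2p : (0 <= ((2 * M) `^ p)%:E)%E) sI.
    exact: leeD hA hB.
  rewrite -EFinM -EFinD lee_fin.
  have -> : (2 * M) `^ p * (N%:R * (2 * dl)) = e1 / 2.
    by rewrite /dl; move: N0 M2p; move: (N%:R : R) (_ `^ p) => n m n0 m0; field; lra.
  by lra.
have -> : (fun w => quantile nu (U w) - quantile mu (U w))%R =
    (fun w => (X w - clamp M (X w)) +
      ((clamp M (X w) - clamp M (Y w)) + (clamp M (Y w) - Y w))).
  by apply/funext => w; rewrite addrA subrKA subrKA.
have h2 := momentD_le P p1 (measurable_funB mcX mcY) (measurable_funB mcY mY).
apply: le_lt_trans (momentD_le P p1 (measurable_funB mX mcX)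
  (measurable_funD (measurable_funB mcX mcY) (measurable_funB mcY mY))) _.
apply: (@le_lt_trans _ _ (K%:E * (e1%:E + K%:E * (e1%:E + e1%:E)))%E).
  have h3 := leeD momXY (ltW momY).
  have h4 := le_trans h2 (lee_wpmul2l (ltW K0 : (0 <= K%:E)%E) h3).
  exact: (lee_wpmul2l (ltW K0 : (0 <= K%:E)%E) (leeD (ltW momX) h4)).
rewrite [ltLHS](_ : _ = (K * (e1 + K * (e1 + e1)))%:E)// lte_fin.
have eE : e = 4 * K * (K * e1).
  by rewrite /e1 expr2; field; rewrite gt_eqF.
have K1e : K * e1 <= K * (K * e1) by rewrite ler_pM2l// ler_peMl// ltW.
have Ke0 : 0 < K * (K * e1) := mulr_gt0 K0 (mulr_gt0 K0 e10).
by rewrite eE; lra.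
Unshelve. all: end_near. Qed.

End quantile_uniform.

(** * Weak majorization and cell averages *)

Section weak_majorization.
Context (R : realType) (n : nat) (F : ('I_n -> R) -> R).
Hypothesis F_convex : forall (t : R) a b, 0 <= t <= 1 ->
  F (fun i => t * a i + (1 - t) * b i) <= t * F a + (1 - t) * F b.
Hypothesis F_mono : forall a b : 'I_n -> R, (forall i, a i <= b i) -> F a <= F b.
Hypothesis F_sym : forall i j a, F (a \o tperm i j) = F a.

(* One transfer of mass [e] from [y j] to [y k] makes [y] agree with [x] at [j]
   or at [k], and does not increase [F]. *)
Lemma weak_majorization_le x y : (forall i j : 'I_n, (i <= j)%N -> x j <= x i) ->
  (forall m, \sum_(i < n | (i < m)%N) x i <= \sum_(i < n | (i < m)%N) y i) ->
  F x <= F y.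
Proof.
move=> xnoninc; have [N] := ubnP #|[set i | x i != y i]%SET|.
elim: N y => // N IH y cardN prefix.
have [xy|/existsNP[k0 /negP]] := pselect (forall i, x i <= y i); first exact: F_mono.
rewrite -ltNge => k0P.
(* [k] is the first index where [y] falls short of [x]. The prefix inequality up to [k] forces a
   surplus at some earlier [j], and [x] being nonincreasing gives [y k < x k <= x j < y j]. *)
case: (@arg_minnP _ k0 (fun k => y k < x k) (fun k => k : nat) k0P) => k kP kmin {k0 k0P}.
have le_lt_k (i : 'I_n) : (i < k)%N -> x i <= y i.
  by move=> ik; rewrite leNgt; apply/negP => /kmin; rewrite leqNgt ik.
have [j jk jP] : exists2 j : 'I_n, (j < k)%N & x j < y j.
  apply: contrapT => noj; have := prefix k.+1; apply/negP; rewrite -ltNge.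
  rewrite (bigD1 k)//= [ltRHS](bigD1 k)//= ltr_leD// ler_sum// => i /andP[ik ik'].
  rewrite leNgt; apply/negP => xyi; apply: noj; exists i => //.
  by rewrite ltn_neqAle -ltnS ik andbT; apply: contra ik' => /eqP ?; apply/eqP/val_inj.
have jk' : j != k by apply: contraTneq jk => ->; rewrite ltnn.
have xkj : x k <= x j by exact/xnoninc/ltnW.
pose e := Num.min (y j - x j) (x k - y k).
have e0 : 0 < e by rewrite lt_min !subr_gt0 jP.
have ej : e <= y j - x j by rewrite ge_min lexx.
have ek : e <= x k - y k by rewrite ge_min lexx orbT.
pose z i := if i == j then y j - e else if i == k then y k + e else y i.
have zj : z j = y j - e by rewrite /z eqxx.
have zk : z k = y k + e by rewrite /z eqxx eq_sym (negbTE jk').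
have zy i : i != j -> i != k -> z i = y i by rewrite /z => /negbTE-> /negbTE->.
have Fz : F z <= F y.
  (* The transfer is the combination [t y + (1 - t) (y o tperm j k)], with [t] chosen so that
     [(1 - t) (y j - y k) = e]; by symmetry both ends have the same [F]. *)
  pose t := 1 - e / (y j - y k).
  have yjk : 0 < y j - y k by lra.
  have t01 : 0 <= t <= 1.
    have : 0 <= e / (y j - y k) <= 1.
      by rewrite divr_ge0 ?(ltW e0) ?(ltW yjk)//= ler_pdivrMr//; lra.
    by rewrite /t; lra.
  have := F_convex y (y \o tperm j k) t01; rewrite F_sym.
  rewrite -mulrDl subrKC mul1r; apply: le_trans.
  rewrite le_eqVlt; apply/orP; left; apply/eqP; congr F; apply/funext => i /=.
  have tE : (1 - t) * (y j - y k) = e by rewrite /t subKr divfK// gt_eqF.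
  have [->|ij] := eqVneq i j; first by rewrite tpermL zj; lra.
  have [->|ik] := eqVneq i k; first by rewrite tpermR zk; lra.
  by rewrite tpermD 1?eq_sym// zy//; lra.
apply: le_trans Fz; apply: IH.
- rewrite -ltnS; apply: leq_ltn_trans cardN; apply: proper_card; apply/properP; split.
    apply/fintype.subsetP => i; rewrite !inE.
    have [->|ij] := eqVneq i j; first by rewrite (lt_eqF jP).
    have [->|ik] := eqVneq i k; first by rewrite (gt_eqF kP).
    by rewrite zy.
  have [ejk|ejk] := leP (y j - x j) (x k - y k).
    exists j; rewrite !inE ?(lt_eqF jP)// negbK zj.
    by rewrite /e min_l// subKr.
  exists k; rewrite !inE ?(gt_eqF kP)// negbK zk.
  by rewrite /e min_r ?ltW// addrC subrK.
(* Prefixes ending before [k] satisfy [x <= z] term by term; longer ones contain both [j] and [k],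
   so the transfer leaves their sum unchanged. *)
- move=> m; have [mk|km] := leqP m k.
    apply: ler_sum => i im; have ik := leq_trans im mk.
    have [->|ij] := eqVneq i j; first by rewrite zj; lra.
    by rewrite zy ?le_lt_k//; apply: contraTneq ik => ->; rewrite ltnn.
  apply: le_trans (prefix m) _.
  have jm := ltn_trans jk km.
  rewrite (bigD1 j)//= (bigD1 k)/=; last by rewrite km eq_sym.
  rewrite [leRHS](bigD1 j)//= [X in _ <= _ + X](bigD1 k)/=; last by rewrite km eq_sym.
  rewrite zj zk !addrA lerD//; first by lra.
  by apply: ler_sum => i /andP[/andP[_ ij] ik]; rewrite zy.
Qed.

End weak_majorization.

(** * Uniform variables with values in the open unit interval *)

Section uniform_rv.
Context d (T : measurableType d) (R : realType) (P : probability T R).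
Variables (U : {RV P >-> R}).
Hypothesis U01 : uniform01 U.

Lemma uniform01_itvoo (a b : R) : 0 <= a -> a <= b -> b <= 1 ->
  P [set w | a < U w < b] = (b - a)%:E.
Proof.
move=> a0 ab b1.
have -> : [set w | a < U w < b] = U @^-1` `]a, b[%classic.
  by apply/seteqP; split => w /=; rewrite in_itv.
rewrite [LHS](U01 (measurable_itv `]a, b[)).
rewrite /uniform_prob integral_uniform_pdf.
rewrite (_ : _ `&` _ = `]a, b[%classic); last first.
  apply/seteqP; split=> y /=; rewrite !in_itv/=; first by case.
  move=> /andP[ay yb]; rewrite ay yb; split => //.
  by rewrite (le_trans a0 (ltW ay)) (le_trans (ltW yb)).
rewrite (eq_integral (cst 1%E)); last first.
  move=> y; rewrite inE/= in_itv/= => /andP[ay yb].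
  by rewrite /uniform_pdf (le_trans a0 (ltW ay)) (le_trans (ltW yb) b1)/= subr0 invr1.
rewrite integral_cst//= mul1e lebesgue_measure_itv/= lte_fin.
have [_|ba] := ltP a b; first by rewrite EFinB.
have -> : a = b by apply/le_anti; rewrite ab ba.
by rewrite subrr.
Qed.

(** [U] is reset to [1/2] on the null event where it leaves []0, 1[]. With all values in []0, 1[],
    where [quantile_le] applies, the monotonicity of quantiles can be used at every point. *)
Lemma uniform01_oo : exists2 V : {RV P >-> R}, uniform01 V & forall w, 0 < V w < 1.
Proof.
pose V w := if 0 < U w < 1 then U w else 2^-1.
have mU : measurable_fun setT U by [].
have m01 : measurable [set w | 0 < U w < 1].
  have -> : [set w | 0 < U w < 1] = U @^-1` `]0, 1[%classic.
    by apply/seteqP; split => w /=; rewrite in_itv.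
  by rewrite -[X in measurable X]setTI; exact: mU.
have mV : measurable_fun setT (V : T -> R).
  apply: measurable_fun_ifT => //.
  apply: (measurable_fun_bool true).
  by rewrite setTI.
have VU : {ae P, forall w, V w = U w}.
  exists (~` [set w | 0 < U w < 1]); split.
  - exact: measurableC.
  - have := probability_setC P m01; rewrite uniform01_itvoo ?ler01// => ->.
    by rewrite subr0 subee.
  - by move=> w /= VU /= w01; apply: VU; rewrite /V w01.
exists (mfun_Sub (mem_set mV) : {RV P >-> R}) => [A mA|w].
  by rewrite -(U01 mA); exact: (ae_eq_preimage mV mU mA VU).
rewrite /= /V; case: ifPn => // _.
by rewrite invr_gt0 ltr0n/= invf_lt1// ltr1n.
Qed.

End uniform_rv.

(** * Averages over cells of equal probability *)

Section equipartition.
Context d (T : measurableType d) (R : realType) (P : probability T R).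
Variables (p : R) (p1 : (1 <= p%:E)%E).
Variables (n : nat) (A : nat -> set T).
Hypotheses (n0 : (0 < n)%N) (mA : forall k, measurable (A k))
  (tA : trivIset setT A) (PA : forall k, (k < n)%N -> P (A k) = (n%:R^-1)%:E).
Implicit Types (f g : T -> R) (k : 'I_n) (y : 'I_n -> R).

Let p_ge1 : 1 <= p. Proof. by rewrite -lee_fin. Qed.
Let p_gt0 : 0 < p. Proof. exact: lt_le_trans p_ge1. Qed.
Let n_gt0 : 0 < n%:R :> R. Proof. by rewrite ltr0n. Qed.

Let UA := \big[setU/set0]_(k < n) A k.

Let mUA : measurable UA. Proof. exact: bigsetU_measurable. Qed.

Let UAP w : UA w <-> exists k : 'I_n, A k w.
Proof.
rewrite /UA -(bigcup_mkord n A); split=> [[k kn kw]|[k kw]].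
  by exists (Ordinal kn).
by exists k => //=.
Qed.

Let PUA : P (~` UA) = 0%E.
Proof.
have PU1 : P UA = 1%E.
  rewrite /UA measure_bigsetU//= (eq_bigr (fun=> (n%:R^-1)%:E)); last by move=> k _; exact: PA.
  by rewrite sumEFin sumr_const card_ord -[n%:R^-1 *+ n]mulr_natl mulfV ?gt_eqF.
have := probability_setC P mUA; rewrite PU1 => ->.
by rewrite subee.
Qed.

Lemma equipartition_ae : {ae P, forall w, exists k : 'I_n, A k w}.
Proof.
exists (~` UA); split => //; first exact: measurableC.
by move=> w /= kw /UAP.
Qed.

Let trivA : trivIset [set` index_enum 'I_n] (fun k : 'I_n => A k).
Proof. by move=> i j _ _ ij; apply/val_inj; exact: tA. Qed.

Let setTUA : setT `\` ~` UA = UA. Proof. by rewrite setTD setCK. Qed.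

Lemma ge0_integral_equipartition f : measurable_fun setT f -> (forall w, 0 <= f w) ->
  (\int[P]_w (f w)%:E = \sum_(k < n) \int[P]_(w in A k) (f w)%:E)%E.
Proof.
move=> mf f0; have mEf : measurable_fun setT (EFin \o f) by exact/measurable_EFinP.
rewrite (ge0_negligible_integral (measurableC mUA) _ mEf _ PUA)//; last first.
  by move=> w _; rewrite lee_fin.
rewrite setTUA ge0_integral_bigsetU//; first exact: index_enum_uniq.
  exact: measurable_funTS.
by move=> w _; rewrite lee_fin.
Qed.

(** As [A k] has probability [1/n], this is the conditional mean of [f] on [A k], and
    [step (cellmean f)] is the conditional expectation given the partition. *)
Definition cellmean f k : R := n%:R * Rintegral P (A k) f.

Lemma le_cellmean f g k : P.-integrable setT (EFin \o f) ->
  P.-integrable setT (EFin \o g) -> (forall w, A k w -> f w <= g w) ->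
  cellmean f k <= cellmean g k.
Proof.
move=> If Ig fg; rewrite ler_pM2l//; apply: le_Rintegral => //.
- exact: integrableS If.
- exact: integrableS Ig.
Qed.

Lemma cellmean_cst f k c : (forall w, A k w -> f w = c) -> cellmean f k = c.
Proof.
move=> fc; rewrite /cellmean (@eq_Rintegral _ _ _ _ _ (cst c)); last first.
  by move=> w /[!inE]; exact: fc.
rewrite Rintegral_cst//.
have -> : fine (P (A k)) = n%:R^-1 by rewrite PA.
by rewrite mulrCA mulfV ?mulr1// gt_eqF.
Qed.

Lemma cellmeanB f g k : P.-integrable setT (EFin \o f) ->
  P.-integrable setT (EFin \o g) ->
  cellmean (fun w => f w - g w) k = cellmean f k - cellmean g k.
Proof.
move=> If Ig; rewrite -mulrBr; congr (_ * _); apply: RintegralB => //.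
- exact: integrableS If.
- exact: integrableS Ig.
Qed.

Lemma sum_cellmean f : P.-integrable setT (EFin \o f) ->
  \sum_(k < n) cellmean f k = n%:R * Rintegral P setT f.
Proof.
move=> If; rewrite -mulr_sumr; congr (_ * _).
have mf : measurable_fun setT f by apply/measurable_EFinP; exact: measurable_int If.
rewrite /Rintegral (negligible_integral (measurableC mUA) _ If PUA)//.
rewrite setTUA integral_bigsetU_EFin//; first last.
- by apply: measurable_funTS; exact/measurable_EFinP.
- exact: index_enum_uniq.
rewrite sum_fine// => k _.
by apply: integrable_fin_num => //; exact: integrableS If.
Qed.

Definition step y (w : T) : R := \sum_(k < n) y k * \1_(A k) w.

Lemma stepE y k w : A k w -> step y w = y k.
Proof.
move=> kw; rewrite /step (bigD1 k)//= indicE mem_set// mulr1 big1 ?addr0// => i ik.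
rewrite indicE memNset ?mulr0// => iw.
by move/eqP: ik; apply; apply/val_inj; apply: (tA (i := i) (j := k)) => //; exists w.
Qed.

Lemma measurable_step y : measurable_fun setT (step y).
Proof.
by apply: measurable_sum => k; apply: measurable_funM => //; exact: measurable_indic.
Qed.

Lemma step_Lfun y : step y \in Lfun P p%:E.
Proof.
apply: (@le_Lfun _ _ _ _ _ p1 _ (cst (\sum_(k < n) `|y k|))).
- exact: measurable_step.
- exact: Lfun_cst.
apply: aeW => w /=; rewrite [leRHS]ger0_norm ?sumr_ge0// /step (le_trans (ler_norm_sum _ _ _))//.
apply: ler_sum => k _; rewrite normrM ler_piMr// indicE ger0_norm ?ler0n//.
by case: (_ \in _).
Qed.

Lemma integral_step y : (forall k, 0 <= y k) ->
  (\int[P]_w (step y w)%:E = (n%:R^-1 * \sum_(k < n) y k)%:E)%E.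
Proof.
move=> y0; rewrite ge0_integral_equipartition//; first last.
- by move=> w; apply: sumr_ge0 => k _; rewrite mulr_ge0// indicE ler0n.
- exact: measurable_step.
rewrite mulr_sumr -sumEFin; apply: eq_bigr => k _.
rewrite (eq_integral (cst (y k)%:E)); last first.
  by move=> w /[!inE] kw; rewrite (stepE _ kw).
rewrite integral_cst// EFinM muleC; congr (_ * _)%E; exact: PA.
Qed.

Lemma moment_step y :
  moment P p (step y) = (n%:R^-1 * \sum_(k < n) `|y k| `^ p)%:E.
Proof.
rewrite -integral_step; last by move=> k; exact: powR_ge0.
apply: ge0_ae_eq_integral => //.
- apply/measurable_EFinP; apply: measurable_fun_norm_powR; exact: measurable_step.
- apply/measurable_EFinP; exact: measurable_step.
- move=> w _; rewrite lee_fin; apply: sumr_ge0 => k _.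
  by rewrite mulr_ge0 ?powR_ge0// indicE ler0n.
- by apply: filterS equipartition_ae => w [k kw] _; rewrite !(stepE _ kw).
Qed.

(** The law of [step y] is the uniform average of the point masses at the [y k], which ignores the
    order of the values. *)
Lemma step_law y i j (B : set R) : measurable B ->
  P (step (y \o tperm i j) @^-1` B) = P (step y @^-1` B).
Proof.
move=> mB.
have PE z : P (step z @^-1` B) = (n%:R^-1 * \sum_(k < n) \1_B (z k))%:E.
  rewrite -integral_step; last by move=> k; rewrite indicE ler0n.
  have mz : measurable (step z @^-1` B).
    by rewrite -[X in measurable X]setTI; exact: measurable_step.
  rewrite -[LHS](congr1 P (setIT _)) -integral_indic//.
  apply: ge0_ae_eq_integral => //.
  - apply/measurable_EFinP; exact: measurable_indic.
  - apply/measurable_EFinP; exact: measurable_step.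
  - move=> w _; rewrite lee_fin; apply: sumr_ge0 => k _.
    by rewrite mulr_ge0// indicE ler0n.
  - apply: filterS equipartition_ae => w [k kw] _; rewrite (stepE _ kw).
    by rewrite !indicE; congr ((nat_of_bool _)%:R%:E); apply/idP/idP;
      rewrite !inE /= (stepE _ kw).
rewrite !PE; congr (_ * _)%:E.
by rewrite [RHS](reindex_inj (@perm_inj _ (tperm i j))).
Qed.

(** Jensen's inequality on one cell: average over the cell the tangent of [t ^ p] at
    [m = |cellmean f k|], whose slope is [a], and use that the mean of [|f|] is at least [m]. *)
Lemma norm_cellmean_powR_le f k : f \in Lfun P p%:E ->
  `|cellmean f k| `^ p <= cellmean (fun w => `|f w| `^ p) k.
Proof.
move=> fp; set m := `|cellmean f k|.
have If := Lfun_integrable1 p1 fp.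
have Ip := Lfun_integrable p_ge1 fp.
have Inf : P.-integrable setT (EFin \o (fun w => `|f w|)).
  by have := integrable_abse If; apply: eq_integrable.
have mle : m <= cellmean (fun w => `|f w|) k.
  rewrite /m /cellmean normrM ger0_norm ?ler0n// ler_pM2l//.
  by apply: le_normr_Rintegral => //; exact: integrableS If.
pose a := p * m `^ (p - 1).
have a0 : 0 <= a by rewrite mulr_ge0 ?powR_ge0// ltW.
have Icst c : P.-integrable setT (EFin \o (fun=> c : R) : T -> _).
  exact: finite_measure_integrable_cst.
have Ia : P.-integrable setT (EFin \o (fun w => a * `|f w|)).
  by have := integrableZl measurableT a Inf; apply: eq_integrable.
have tan w : a * `|f w| - (a * m - m `^ p) <= `|f w| `^ p.
  have := powR_tangent_le p_ge1 (normr_ge0 (cellmean f k)) (normr_ge0 (f w)).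
  by rewrite -/m -/a; lra.
have : cellmean (fun w => a * `|f w| - (a * m - m `^ p)) k <= cellmean (fun w => `|f w| `^ p) k.
  apply: le_cellmean => //.
  by have := integrableB measurableT Ia (Icst (a * m - m `^ p)); apply: eq_integrable.
apply: le_trans; rewrite cellmeanB//.
rewrite (@cellmean_cst (fun=> a * m - m `^ p) k (a * m - m `^ p))//.
have -> : cellmean (fun w => a * `|f w|) k = a * cellmean (fun w => `|f w|) k.
  rewrite /cellmean RintegralZl//; last exact: integrableS Inf.
  by rewrite mulrCA.
by have := ler_wpM2l a0 mle; lra.
Qed.

Lemma moment_step_cellmean_le f : f \in Lfun P p%:E ->
  (moment P p (step (cellmean f)) <= moment P p f)%E.
Proof.
move=> fp; have Ip := Lfun_integrable p_ge1 fp.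
rewrite moment_step /moment.
rewrite -[leRHS]fineK; last exact: integrable_fin_num Ip.
rewrite lee_fin.
rewrite -[leRHS](mulKf (lt0r_neq0 n_gt0)).
rewrite -/(Rintegral P setT (fun w => `|f w| `^ p)) -sum_cellmean//.
rewrite ler_pM2l ?invr_gt0//; apply: ler_sum => k _; exact: norm_cellmean_powR_le.
Qed.

(** Averaging fixes step functions, so the error is the average of [f - step y] plus [step y - f],
    and averaging does not increase the moment. Hence cell means approximate [f] as well as any step
    function, up to a constant. *)
Lemma moment_cellmean_sub_le f y : f \in Lfun P p%:E ->
  (moment P p (fun w => step (cellmean f) w - f w)%R <=
   (2 `^ p * 2)%:E * moment P p (fun w => step y w - f w)%R)%E.
Proof.
move=> fp; have yp := step_Lfun y.
have fyp := LfunB_fun p1 fp yp.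
have mf := Lfun_measurable p1 fp; have my := measurable_step y.
have e : (fun w => step (cellmean f) w - f w) =
    (fun w => step (cellmean (fun w => f w - step y w)) w + (step y w - f w)).
  apply/funext => w; rewrite addrA; congr (_ - _).
  rewrite /step -big_split/=; apply: eq_bigr => k _; rewrite -mulrDl; congr (_ * _).
  rewrite cellmeanB; [|exact: (Lfun_integrable1 p1)..].
  by rewrite (@cellmean_cst (step y) k (y k)) ?subrK// => w'; exact: stepE.
rewrite e; apply: le_trans (momentD_le P p1 (measurable_step _) (measurable_funB my mf)) _.
rewrite EFinM -muleA lee_pmul2l ?lte_fin ?powR_gt0//.
have -> : (2%:E * moment P p (fun w => step y w - f w)%R =
  moment P p (fun w => step y w - f w)%R + moment P p (fun w => step y w - f w)%R)%E.
  by rewrite -mule2n mule_natl.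
apply: leeD => //; apply: le_trans (moment_step_cellmean_le fyp) _.
apply: le_moment => //; [exact: measurable_funB|exact: measurable_funB|].
by apply: aeW => w; rewrite distrC.
Qed.

End equipartition.

(** * Quantiles averaged over ordered cells *)

Section quantile_cells.
Context d (T : measurableType d) (R : realType) (P : probability T R).
Variables (p : R) (p1 : (1 <= p%:E)%E) (U : {RV P >-> R}).
Hypotheses (U01 : uniform01 U) (Uoo : forall w, 0 < U w < 1).
Implicit Types mu nu : moment_probability p.

Let p_ge1 : 1 <= p. Proof. by rewrite -lee_fin. Qed.
Let p_gt0 : 0 < p. Proof. exact: lt_le_trans p_ge1. Qed.

Local Notation Q mu := (fun w => quantile mu (U w)).

Lemma quantile_comp_Lfun mu (f : R -> R) : f \in Lfun mu p%:E ->
  (fun w => f (quantile mu (U w))) \in Lfun P p%:E.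
Proof.
move=> fp; have mf := Lfun_measurable p1 fp.
apply/(Lfun_momentP _ p1); split.
  exact: (measurableT_comp mf (measurable_quantile_rv U mu)).
apply: le_lt_trans (Lfun_moment_lty p1 fp); rewrite le_eqVlt; apply/orP; left.
apply/eqP; apply: (ge0_integral_quantile U01 mu (f := fun t => `|f t| `^ p)).
  exact: measurable_fun_norm_powR.
by move=> t; exact: powR_ge0.
Qed.

Lemma Rintegral_quantile mu (f : R -> R) : f \in Lfun mu p%:E ->
  Rintegral P setT (fun w => f (quantile mu (U w))) = Rintegral mu setT f.
Proof.
move=> fp; have mf := Lfun_measurable p1 fp.
have If := Lfun_integrable1 p1 (quantile_comp_Lfun fp).
pose X : {RV P >-> R} := (quantile mu \o U) : {RV P >-> R}.
have mEf : measurable_fun setT (EFin \o f) by exact/measurable_EFinP.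
congr fine; transitivity (\int[distribution P X]_t (f t)%:E)%E.
  exact/esym/(integral_distribution (X := X) mEf If).
by apply: eq_measure_integral => A mA _; exact: quantile_distribution.
Qed.

Lemma id_Lfun mu : (fun s : R => s) \in Lfun mu p%:E.
Proof.
by apply/(Lfun_momentP _ p1); split => //; exact: moment_probability_fin.
Qed.

Lemma stop_loss_Lfun mu (c : R) : (fun s : R => Num.max 0 (s - c)) \in Lfun mu p%:E.
Proof.
apply: (le_Lfun p1 _ (LfunB_fun p1 (id_Lfun mu) (Lfun_cst mu c p))).
  apply: measurable_maxr => //; exact: measurable_funB.
apply: aeW => s /=; rewrite ger0_norm ?le_max ?lexx// ge_max normr_ge0.
exact: ler_norm.
Qed.

Variable n : nat.
Hypothesis n0 : (0 < n)%N.
Let n_gt0 : 0 < n%:R :> R. Proof. by rewrite ltr0n. Qed.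

(** The levels decrease from [t 0 = 1] to [t n = 0], so cell 0 carries the largest values of [U] and
    the averages of a quantile come out nonincreasing, as [weak_majorization_le] expects. *)
Let t (k : nat) : R := 1 - k%:R / n%:R.

Definition cell (k : nat) : set T := [set w | t k.+1 < U w < t k].

Let t_homo i j : (i <= j)%N -> t j <= t i.
Proof. by move=> ij; rewrite lerD2l lerN2 ler_pM2r ?invr_gt0// ler_nat. Qed.

Let t_lt k : t k.+1 < t k.
Proof. by rewrite ltrD2l ltrN2 ltr_pM2r ?invr_gt0// ltr_nat. Qed.

Let t0 : t 0 = 1. Proof. by rewrite /t mul0r subr0. Qed.

Let tn : t n = 0. Proof. by rewrite /t divff ?subrr// gt_eqF. Qed.

Let t_oo k : (0 < k)%N -> (k < n)%N -> 0 < t k < 1.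
Proof.
move=> k0 kn; apply/andP; split.
  by apply: le_lt_trans (t_lt k); rewrite -[leLHS]tn t_homo.
by apply: le_lt_trans (t_homo k0) _; rewrite -[ltRHS]t0.
Qed.

Lemma measurable_cell k : measurable (cell k).
Proof.
have -> : cell k = U @^-1` `]t k.+1, t k[%classic.
  by apply/seteqP; split => w /=; rewrite in_itv.
have mU : measurable_fun setT U by [].
by rewrite -[X in measurable X]setTI; exact: mU.
Qed.

Lemma trivIset_cell : trivIset setT cell.
Proof.
have lt_disj i j w : (i < j)%N -> cell i w -> cell j w -> False.
  move=> ij /andP[iw _] /andP[_ jw].
  by have := lt_le_trans (lt_trans iw jw) (t_homo ij); rewrite ltxx.
move=> i j _ _ [w [iw jw]]; have [ij|ji|//] := ltngtP i j.
  by have := lt_disj _ _ _ ij iw jw.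
by have := lt_disj _ _ _ ji jw iw.
Qed.

Lemma probability_cell k : (k < n)%N -> P (cell k) = (n%:R^-1)%:E.
Proof.
move=> kn; rewrite uniform01_itvoo//.
- by congr EFin; rewrite /t -natr1; field; rewrite gt_eqF.
- by rewrite -[leLHS]tn t_homo.
- exact/ltW/t_lt.
- by rewrite -[leRHS]t0 t_homo.
Qed.

Let quantile_cell_le mu k w j : (0 < j)%N -> (j <= k)%N -> (j < n)%N -> cell k w ->
  quantile mu (U w) <= quantile mu (t j).
Proof.
move=> j0 jk jn /andP[_ wk]; have /andP[U0 U1] := Uoo w.
have /andP[tj0 tj1] := t_oo j0 jn.
by apply: quantile_homo => //; rewrite (le_trans (ltW wk))// t_homo.
Qed.

Let quantile_cell_ge mu k w j : (k < j)%N -> (j < n)%N -> cell k w ->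
  quantile mu (t j) <= quantile mu (U w).
Proof.
move=> kj jn /andP[kw _]; have /andP[U0 U1] := Uoo w.
have /andP[tj0 tj1] := t_oo (leq_ltn_trans (leq0n _) kj) jn.
by apply: quantile_homo => //; rewrite (le_trans _ (ltW kw))// t_homo.
Qed.

Local Notation cellmean := (@cellmean _ _ _ P n cell).

Let Q_integrable mu : P.-integrable setT (EFin \o Q mu).
Proof. exact: (Lfun_integrable1 p1 (quantile_rv_Lfun U01 mu)). Qed.

Let cst_integrable c : P.-integrable setT (EFin \o (fun=> c : R) : T -> _).
Proof. exact: finite_measure_integrable_cst. Qed.

(** For [i < j] the level [t j] separates the cells: the constant [quantile mu (t j)] bounds the
    quantile from above on cell [j] and from below on cell [i]. *)
Lemma cellmean_quantile_noninc mu (i j : 'I_n) : (i <= j)%N ->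
  cellmean (Q mu) j <= cellmean (Q mu) i.
Proof.
rewrite leq_eqVlt => /predU1P[/val_inj->//|ij].
have c k := @cellmean_cst _ _ _ P n cell n0 measurable_cell probability_cell
  (fun=> quantile mu (t j)) k (quantile mu (t j)) (fun _ _ => erefl).
apply: (@le_trans _ _ (quantile mu (t j))).
  rewrite -[leRHS](c j); apply: le_cellmean => //; first exact: measurable_cell.
  by move=> w; apply: quantile_cell_le => //; exact: leq_ltn_trans ij.
rewrite -[leLHS](c i); apply: le_cellmean => //; first exact: measurable_cell.
by move=> w; apply: quantile_cell_ge.
Qed.

(* For [0 < m < n], compare with the stop-loss function at the threshold
   [quantile nu (t m)]: it dominates [s - quantile nu (t m)], with equality at
   [quantile nu] on the first [m] cells, and vanishes there on the other cells. *)
Lemma cellmean_quantile_prefix mu nu m : icx_le mu nu ->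
  \sum_(k < n | (k < m)%N) cellmean (Q mu) k <=
  \sum_(k < n | (k < m)%N) cellmean (Q nu) k.
Proof.
move=> icx.
have IQ m' c : P.-integrable setT
    (EFin \o (fun w => Num.max 0 (quantile (m' : moment_probability p) (U w) - c))).
  exact: (Lfun_integrable1 p1 (quantile_comp_Lfun (stop_loss_Lfun m' c))).
have le_int (f : R -> R) : {homo f : x y / x <= y} ->
    convex_function [set: R^o] (f : R^o -> R^o) ->
    f \in Lfun mu p%:E -> f \in Lfun nu p%:E ->
    Rintegral P setT (fun w => f (quantile mu (U w))) <=
    Rintegral P setT (fun w => f (quantile nu (U w))).
  move=> fhomo fcvx fmu fnu; rewrite !Rintegral_quantile//.
  by apply: icx => //; exact: (Lfun_integrable1 p1).
have sumE f : P.-integrable setT (EFin \o f) ->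
    \sum_(k < n) cellmean f k = n%:R * Rintegral P setT f.
  exact: (sum_cellmean n0 measurable_cell trivIset_cell probability_cell).
have [nm|mn] := leqP n m.
  (* All cells are included, so both sides are total integrals and the identity is the test
     function. *)
  have sumall (F : 'I_n -> R) : \sum_(k < n | (k < m)%N) F k = \sum_(k < n) F k.
    by apply: eq_bigl => k; rewrite (leq_trans _ nm).
  rewrite !sumall.
  rewrite !sumE// ler_pM2l//; have id_cvx : convex_function [set: R^o] (fun s : R^o => s).
    by move=> l x y _ _; exact: lexx.
  exact: (le_int _ (fun _ _ => id) id_cvx (id_Lfun mu) (id_Lfun nu)).
case: m mn => [_|m0 mn]; first by rewrite !big_pred0.
set m := m0.+1 in mn *.
pose c := quantile nu (t m); pose u (s : R) := Num.max 0 (s - c).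
have u0 s : 0 <= u s by rewrite le_max lexx.
have uE s : s - c <= u s by rewrite le_max lexx orbT.
have uhomo : {homo u : x y / x <= y}.
  by move=> x y xy; rewrite ge_max le_max lexx/= le_max lerB// orbT.
have ucvx : convex_function [set: R^o] (u : R^o -> R^o).
  move=> l x y _ _.
  change (u (l%:num * x + (1 - l%:num) * y) <= l%:num * u x + (1 - l%:num) * u y).
  have l0 : 0 <= l%:num by [].
  have l1 : 0 <= 1 - l%:num by rewrite subr_ge0.
  rewrite [leLHS]/u ge_max addr_ge0 ?mulr_ge0//=.
  have : l%:num * (x - c) <= l%:num * u x by rewrite ler_wpM2l.
  have : (1 - l%:num) * (y - c) <= (1 - l%:num) * u y by rewrite ler_wpM2l.
  by lra.
have uint := le_int u uhomo ucvx (stop_loss_Lfun mu c) (stop_loss_Lfun nu c).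
have cB k m' : cellmean (fun w => quantile (m' : moment_probability p) (U w) - c) k =
    cellmean (Q m') k - c.
  rewrite cellmeanB//; first congr (_ - _); last exact: measurable_cell.
  exact: (cellmean_cst n0 measurable_cell probability_cell).
have IB m' : P.-integrable setT
    (EFin \o (fun w => quantile (m' : moment_probability p) (U w) - c)).
  by have := integrableB measurableT (Q_integrable m') (cst_integrable c); apply: eq_integrable.
have X1 : \sum_(k < n | (k < m)%N) (cellmean (Q mu) k - c) <=
    n%:R * Rintegral P setT (fun w => u (quantile mu (U w))).
  rewrite -sumE; last exact: IQ.
  rewrite [leRHS](bigID (fun k : 'I_n => (k < m)%N))/= -[leLHS]addr0 lerD//.
    apply: ler_sum => k _; rewrite -cB; apply: le_cellmean => //; first exact: measurable_cell.
    exact: IQ.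
  apply: sumr_ge0 => k _; rewrite mulr_ge0 ?ler0n// Rintegral_ge0//.
have Y1 : n%:R * Rintegral P setT (fun w => u (quantile nu (U w))) =
    \sum_(k < n | (k < m)%N) (cellmean (Q nu) k - c).
  rewrite -sumE; last exact: IQ.
  rewrite (bigID (fun k : 'I_n => (k < m)%N))/= [X in _ + X]big1 ?addr0.
    apply: eq_bigr => k km; rewrite -cB; congr (_ * _); apply: eq_Rintegral => w.
    rewrite inE => kw; apply/max_idPr; rewrite subr_ge0.
    exact: quantile_cell_ge kw.
  move=> k; rewrite -leqNgt => mk; apply: (cellmean_cst n0 measurable_cell probability_cell).
  by move=> w kw; apply/max_idPl; rewrite subr_le0; exact: quantile_cell_le kw.
have : \sum_(k < n | (k < m)%N) (cellmean (Q mu) k - c) <=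
    \sum_(k < n | (k < m)%N) (cellmean (Q nu) k - c).
  by rewrite -Y1; apply: le_trans X1 _; rewrite ler_pM2l.
by rewrite !sumrB lerD2r.
Qed.

(* Compare with the step function taking on each cell the supremum of the
   clamped quantile: its jumps telescope to [2 * M]. *)
Lemma moment_cellmean_quantile_le mu (M : R) : 0 < M ->
  (moment P p (fun w => step cell (cellmean (Q mu)) w - quantile mu (U w))%R <=
   (2 `^ p * 2 * 2 `^ p *
     ((2 * M) `^ p / n%:R + Rintegral mu setT (tail p M)))%:E)%E.
Proof.
move=> M0.
(* The levels [t 0 = 1] and [t n = 0] lie outside []0, 1[], where [quantile_le] does not apply; the
   clamp bounds [M] and [- M] stand in there. *)
pose b (k : nat) := if k == 0%N then M else
  if (k < n)%N then clamp M (quantile mu (t k)) else - M.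
have bM k : - M <= b k <= M.
  rewrite /b; case: ifP => _; first by rewrite lexx andbT; lra.
  by case: ifP => _; [exact/clamp_itv/ltW|rewrite lexx/=; lra].
have bs k s : (k < n)%N -> t k.+1 < s < t k -> b k.+1 <= clamp M (quantile mu s) <= b k.
  move=> kn /andP[ks sk].
  have s0 : 0 < s by apply: le_lt_trans ks; rewrite -[leLHS]tn t_homo.
  have s1 : s < 1 by apply: lt_le_trans sk _; rewrite -[leRHS]t0 t_homo.
  have /andP[cs1 cs2] := clamp_itv (quantile mu s) (ltW M0).
  apply/andP; split; rewrite /b/=.
    case: ifP => // k1n; have /andP[tk0 _] := t_oo (ltn0Sn k) k1n.
    by apply: clamp_homo; apply: quantile_homo => //; exact: ltW.
  case: ifP => // /negbT; rewrite -lt0n kn => k0; have /andP[_ tk1] := t_oo k0 kn.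
  by apply: clamp_homo; apply: quantile_homo => //; exact: ltW.
pose e (k : nat) := b k - b k.+1.
have e0 (k : 'I_n) : 0 <= e k.
  have /andP[h1 h2] : b k.+1 <= clamp M (quantile mu ((t k + t k.+1) / 2)) <= b k.
    by apply: bs => //; have := t_lt k; lra.
  by rewrite subr_ge0 (le_trans h1).
have e2M k : e k <= 2 * M.
  by have := bM k; have := bM k.+1; rewrite /e; lra.
have sum_e : \sum_(k < n) e k = 2 * M.
  transitivity (- \sum_(0 <= k < n) (b k.+1 - b k)).
    by rewrite big_mkord -sumrN; apply: eq_bigr => k _; rewrite opprB.
  by rewrite telescope_sumr// /b eqxx ltnn gtn_eqF//; lra.
pose y (k : 'I_n) := b k.
have mX := measurable_quantile_rv U mu.
have mcX : measurable_fun setT (fun w => clamp M (quantile mu (U w))).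
  exact: (measurableT_comp (measurable_clamp M) mX).
have my : measurable_fun setT (step cell y) by exact: (measurable_step measurable_cell).
have dist_clamp : (moment P p (fun w => step cell y w - clamp M (quantile mu (U w)))%R <=
    ((2 * M) `^ p / n%:R)%:E)%E.
  (* On cell [k] the error is at most [e k <= 2 * M], so its [p]-th power is at most [z k], which is
     linear in the jump and can be telescoped. *)
  pose z (k : 'I_n) := (2 * M) `^ (p - 1) * e k.
  have z0 k : 0 <= z k by rewrite mulr_ge0 ?powR_ge0.
  have -> : (2 * M) `^ p / n%:R = n%:R^-1 * \sum_(k < n) z k.
    rewrite -mulr_sumr sum_e [in RHS]mulrC; congr (_ / _).
    by rewrite [RHS]mulrC mulr_powRB1// mulr_ge0// ltW.
  rewrite -(integral_step n0 measurable_cell trivIset_cell probability_cell)//.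
  apply: ae_ge0_le_integral_EFin.
  - by apply: measurable_fun_norm_powR; exact: measurable_funB.
  - exact: (measurable_step measurable_cell).
  - by move=> w; exact: powR_ge0.
  - by move=> w; apply: sumr_ge0 => k _; rewrite mulr_ge0// indicE ler0n.
  apply: filterS (equipartition_ae n0 measurable_cell trivIset_cell probability_cell).
  move=> w [k kw]; rewrite !(stepE trivIset_cell _ kw).
  have /andP[h1 h2] := bs k (U w) (ltn_ord k) kw.
  apply: (@le_trans _ _ (e k `^ p)).
    rewrite ge0_ler_powR ?nnegrE ?(ltW p_gt0)// ger0_norm ?subr_ge0//.
    by rewrite /e /y lerD2l lerN2.
  rewrite -mulr_powRB1// [leLHS]mulrC ler_wpM2r//.
  apply: ge0_ler_powR; rewrite ?nnegrE ?subr_ge0//.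
    exact: le_trans h2.
  by apply: mulr_ge0 => //; exact: ltW.
have dist_tail : moment P p (fun w => clamp M (quantile mu (U w)) - quantile mu (U w))%R =
    (Rintegral mu setT (tail p M))%:E.
  rewrite /moment; under eq_integral do rewrite distrC norm_sub_clamp ?(ltW M0)//.
  rewrite (ge0_integral_quantile U01 mu (measurable_tail p1 M) (tail_ge0 p M)).
  by rewrite EFin_Rintegral_tail ?(ltW M0).
apply: le_trans (moment_cellmean_sub_le p1 n0 measurable_cell trivIset_cell
  probability_cell y (quantile_rv_Lfun U01 mu)) _.
rewrite (EFinM (2 `^ p * 2 * 2 `^ p)) (EFinM (2 `^ p * 2)) -muleA.
have K0 : (0 <= (2 `^ p * 2)%:E :> \bar R)%E by rewrite lee_fin mulr_ge0 ?powR_ge0.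
apply: (lee_wpmul2l K0).
have -> : (fun w => step cell y w - quantile mu (U w))%R =
    (fun w => (step cell y w - clamp M (quantile mu (U w))) +
      (clamp M (quantile mu (U w)) - quantile mu (U w))).
  by apply/funext => w; rewrite subrKA.
apply: le_trans (momentD_le P p1 (measurable_funB my mcX) (measurable_funB mcX mX)) _.
have K1 : (0 <= (2 `^ p)%:E :> \bar R)%E by rewrite lee_fin powR_ge0.
apply: (lee_wpmul2l K1); rewrite EFinD dist_tail.
exact: (leeD dist_clamp (lexx _)).
Qed.

End quantile_cells.

(** * Continuity and monotonicity of the risk functional along quantiles *)

Section law_invariant_risk.
Context d (T : measurableType d) (R : realType) (P : probability T R).
Variables (p : R) (p1 : (1 <= p%:E)%E).
Variable rho : LspaceType P p1 -> R.
Hypotheses (rho_cvx : rho_convex rho) (rho_mono : rho_nondecreasing rho)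
  (rho_law : law_invariant rho).
Variables (U : {RV P >-> R}) (U01 : uniform01 U) (Uoo : forall w, 0 < U w < 1).
Implicit Types mu nu : moment_probability p.

Local Notation Q mu := (fun w => quantile mu (U w)).
Local Notation average n mu :=
  (step (cell U n) (@cellmean _ _ _ P n (cell U n) (Q mu))).

Lemma rho_quantile_continuous mu (e : R) : 0 < e ->
  \forall nu \near mu, `|rho_fun rho (Q (nu : moment_probability p)) - rho_fun rho (Q mu)| < e.
Proof.
move=> e0.
have [eta eta0 rhoQ] := convex_mono_continuous p1 (rho_fun_convex rho_cvx)
  (rho_fun_mono rho_mono) (quantile_rv_Lfun U01 mu) e0.
have := near_quantile p1 U01 Uoo mu eta0.
by apply: filterS => nu; apply: rhoQ; exact: quantile_rv_Lfun.
Qed.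

Lemma rho_cellmean_close mu (e : R) : 0 < e ->
  exists N, forall n, (N < n)%N ->
    `|rho_fun rho (average n mu) - rho_fun rho (Q mu)| < e.
Proof.
move=> e0.
have [eta eta0 rhoQ] := convex_mono_continuous p1 (rho_fun_convex rho_cvx)
  (rho_fun_mono rho_mono) (quantile_rv_Lfun U01 mu) e0.
(* The constant of [moment_cellmean_quantile_le]. The choice of [M] for the tail and of [n] for the
   [1/n] term makes each of them less than [eta / (2 * K)]. *)
pose K := 2 `^ p * 2 * 2 `^ p : R.
have K0 : 0 < K by rewrite !mulr_gt0 ?powR_gt0.
have eK0 : 0 < eta / (2 * K) by rewrite divr_gt0// mulr_gt0.
have [M M0 tM] := tail_small p1 mu eK0.
exists (Num.truncn ((2 * M) `^ p / (eta / (2 * K)))) => n Nn.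
have n0 : (0 < n)%N by exact: leq_ltn_trans Nn.
have n_gt0 : 0 < n%:R :> R by rewrite ltr0n.
apply: rhoQ.
  by apply: step_Lfun => // k; exact: measurable_cell.
apply: le_lt_trans (moment_cellmean_quantile_le p1 U01 n0 mu M0) _.
rewrite lte_fin -/K.
have Mn : (2 * M) `^ p / n%:R < eta / (2 * K).
  rewrite ltr_pdivrMr// [ltRHS]mulrC -ltr_pdivrMr//.
  by apply: lt_le_trans (truncnS_gt _) _; rewrite ler_nat.
have -> : eta = K * (eta / (2 * K) + eta / (2 * K)).
  by field; rewrite gt_eqF.
by rewrite ltr_pM2l// ltrD.
Qed.

Lemma rho_cellmean_mono mu nu n : (0 < n)%N -> icx_le mu nu ->
  rho_fun rho (average n mu) <=
  rho_fun rho (average n nu).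
Proof.
move=> n0 icx.
have mcell := measurable_cell U n.
have Lstep y : step (cell U n) y \in Lfun P p%:E by exact: step_Lfun.
apply: (weak_majorization_le (F := fun y : 'I_n -> R => rho_fun rho (step (cell U n) y))).
- move=> t a b t01; rewrite [leLHS](_ : _ = rho_fun rho
    (fun w => t * step (cell U n) a w + (1 - t) * step (cell U n) b w)).
    exact: rho_fun_convex.
  congr rho_fun; apply/funext => w; rewrite /step !mulr_sumr -big_split/=.
  by apply: eq_bigr => k _; rewrite mulrDl !mulrA.
- move=> a b ab; apply: rho_fun_mono => //; apply: aeW => w.
  by apply: ler_sum => k _; rewrite ler_wpM2r// indicE ler0n.
- move=> i j a; apply: rho_fun_law => // B mB.
  exact: (step_law n0 mcell (trivIset_cell n0)
    (probability_cell U01 n0) a i j mB).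
- exact: (cellmean_quantile_noninc p1).
- by move=> m; exact: (cellmean_quantile_prefix p1).
Qed.

Lemma rho_quantile_mono mu nu : icx_le mu nu ->
  rho_fun rho (Q mu) <= rho_fun rho (Q nu).
Proof.
move=> icx; apply/ler_addgt0Pr => e e0.
have [N1 hN1] := rho_cellmean_close mu (divr_gt0 e0 (ltr0n _ 2)).
have [N2 hN2] := rho_cellmean_close nu (divr_gt0 e0 (ltr0n _ 2)).
pose n := (maxn N1 N2).+1.
have := hN1 n (leq_maxl _ _ : (N1 < n)%N); have := hN2 n (leq_maxr _ _ : (N2 < n)%N).
have := rho_cellmean_mono (ltn0Sn _ : (0 < n)%N) icx.
by rewrite !ltr_norml => ? /andP[? ?] /andP[? ?]; lra.
Qed.

End law_invariant_risk.

Theorem theorem2 (R : realType) (p : R) (p1 : (1 <= p%:E)%E)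
    (d : measure_display) (T : measurableType d) (P : probability T R)
    (P_atomless : atomless P)
    (rho : LspaceType P p1 -> R)
    (rho_cvx : rho_convex rho)
    (rho_mono : rho_nondecreasing rho)
    (rho_law : law_invariant rho)
    (U : {RV P >-> R}) (U01 : uniform01 U) :
  continuous (R_rho U01 rho) /\
  (translation_equivariant rho ->
   forall mu nu : moment_probability p,
     icx_le mu nu -> R_rho U01 rho mu <= R_rho U01 rho nu).
Proof.
have [V V01 Voo] := uniform01_oo U01.
(* Both [quantile mu (U w)] and [quantile mu (V w)] have law [mu], so law invariance permits
   replacing [U] by [V]. *)
have R_rhoE mu : R_rho U01 rho mu = rho_fun rho (fun w => quantile mu (V w)).
  rewrite /R_rho -rho_funE; apply: (rho_fun_law rho_law).
  - exact: quantile_rv_Lfun.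
  - exact: quantile_rv_Lfun.
  - move=> A mA; transitivity (mu A); first exact: (quantile_distribution U01).
    exact/esym/(quantile_distribution V01).
split=> [mu|_ mu nu icx].
  apply/cvgrPdist_lt; first exact: (nbhs_filter mu).
  move=> e e0; rewrite R_rhoE.
  apply: (@filterS _ (nbhs mu) (nbhs_filter mu) _ _ _
    (rho_quantile_continuous rho_cvx rho_mono V01 Voo mu e0)) => nu.
  by rewrite R_rhoE distrC.
rewrite !R_rhoE; exact: (rho_quantile_mono rho_cvx rho_mono rho_law V01 Voo).
Qed.
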